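(* Let $\Omega$ be a star graph with $n$ edges $\epsilon_i\cong[0,\ell_i]$, let $V_i\in L^1(0,\ell_i)$ for $1\le i\le n$, and let $\Gamma=\{\alpha_1,\alpha_2,\beta_1,\beta_2\}$ be separated self-adjoint boundary conditions with $\beta_1,\beta_2$ diagonal. Let $1\le j\le n$ and let $s_1\in(0,\ell_j)$ be a non-vertex point of edge $\epsilon_j$. Split $\Omega$ at $s_1$ into $\Omega_1$ (the interval $[s_1,\ell_j]$ of edge $\epsilon_j$) and $\Omega_2$ (the star graph obtained from $\Omega$ by replacing edge $\epsilon_j$ by $[0,s_1]$), and let $\Gamma_1,\Gamma_2$ be the boundary conditions that agree with $\Gamma$ at the vertices shared with $\Omega$ and are Dirichlet at $s_1$. Suppose $\lambda\in\rho(H^{\Omega_1}_{\Gamma_1})\cap\rho(H^{\Omega_2}_{\Gamma_2})$, and let $M_1+M_2$ be the two-sided map at $s_1$. Then $$\frac{E^{\Omega}_{\Gamma}(\lambda)}{E^{\Omega_1}_{\Gamma_1}(\lambda)\,E^{\Omega_2}_{\Gamma_2}(\lambda)}=(M_1+M_2)(\lambda),$$ where $E^{\Omega}_{\Gamma},E^{\Omega_1}_{\Gamma_1},E^{\Omega_2}_{\Gamma_2}$ are the Evans functions associated with $H^{\Omega}_{\Gamma},H^{\Omega_1}_{\Gamma_1},H^{\Omega_2}_{\Gamma_2}$ respectively.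
   Context: **Star graph and functions.** $\Omega$ has $n\ge1$ edges; edge $\epsilon_i$ has coordinate $x_i\in[0,\ell_i]$, $\ell_i>0$, where $x_i=0$ is the common vertex (origin) of all edges. A function on $\Omega$ is a vector $\vec u=(u_1,\dots,u_n)$ with $u_i$ a function of $x_i$; $\vec u'=(u_1',\dots,u_n')$ with $u_i'=du_i/dx_i$; $\vec u(\vec 0)=(u_i(0))_i$ and $\vec u(\vec\ell)=(u_i(\ell_i))_i$. **Boundary conditions.** $\Gamma=\{\alpha_1,\alpha_2,\beta_1,\beta_2\}$ consists of complex $n\times n$ matrices with $\operatorname{rank}[\alpha_1\ \alpha_2]=\operatorname{rank}[\beta_1\ \beta_2]=n$, $\alpha_1\alpha_2^*=\alpha_2\alpha_1^*$, $\beta_1\beta_2^*=\beta_2\beta_1^*$, and $\beta_1=\operatorname{diag}(g_1,\dots,g_n)$, $\beta_2=\operatorname{diag}(h_1,\dots,h_n)$. A function $\vec u$ satisfies $\Gamma$ if $\alpha_1\vec u(\vec 0)+\alpha_2\vec u'(\vec 0)=\vec 0$ and $\beta_1\vec u(\vec\ell)+\beta_2\vec u'(\vec\ell)=\vec 0$. **Operators.** $H^\Omega=\operatorname{diag}(-\partial_{x_i}^2+V_i(x_i))$ is a differential expression. Solutions of $(H^\Omega-\lambda)\vec u=\vec 0$ are understood with $u_i,u_i'$ absolutely continuous on the closed edge and the equation holding a.e. $H^\Omega_\Gamma$ is the operator $\vec u\mapsto H^\Omega\vec u$ in $L^2(\Omega)=\bigoplus_i L^2(0,\ell_i)$ with domain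 the functions $\vec u$ satisfying $\Gamma$ such that $u_i,u_i'$ are absolutely continuous and $-u_i''+V_iu_i\in L^2(0,\ell_i)$ (this is $u_i\in H^2(0,\ell_i)$ when $V_i\in L^2$). $\rho(\cdot)$ denotes the resolvent set; the spectrum is discrete. $H^{\Omega_1},H^{\Omega_2}$ are the restrictions of $H^\Omega$ to the subgraphs, and $H^{\Omega_1}_{\Gamma_1},H^{\Omega_2}_{\Gamma_2}$ are defined in the same way from the boundary conditions below. **Subgraph boundary conditions.** $\Gamma_1$ on $\Omega_1=[s_1,\ell_j]$: $u(s_1)=0$ and $g_ju(\ell_j)+h_ju'(\ell_j)=0$; here $s_1$ plays the role of the origin, with $1\times1$ matrices $\alpha_1=1,\alpha_2=0$, $\beta_1=g_j,\beta_2=h_j$. $\Gamma_2$ on $\Omega_2$: the matrices are those of $\Gamma$, except that the $j$-th diagonal entries of $\beta_1,\beta_2$ are replaced by $1,0$ respectively, and $s_1$ plays the role of $\ell_j$; that is, $u_j(s_1)=0$. **Evans function.** For $\lambda\in\mathbb C$ let $Y(\vec x,\lambda)$, $Z(\vec x,\lambda)$ be the $n\times n$ matrices whose columns are solutions of $(H^\Omega-\lambda)\vec u=\vec 0$ (the $k$-th row being a function of $x_k$) with $$Y(\vec 0)=-\alpha_2^*,\quad Y'(\vec 0)=\alpha_1^*,\qquad Z(\vec\ell)=-\beta_2^*,\quad Z'(\vec\ell)=\beta_1^* .$$ Then $E^\Omega_\Gamma(\lambda)=\det\begin{bmatrix}Y(\vec x,\lambda)&Z(\vec x,\lambda)\\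 Y'(\vec x,\lambda)&Z'(\vec x,\lambda)\end{bmatrix}$, which does not depend on $\vec x$. $E^{\Omega_1}_{\Gamma_1}$ and $E^{\Omega_2}_{\Gamma_2}$ are defined identically with the matrices and endpoints given above (on $\Omega_1$ the point $s_1$ replaces $0$; on $\Omega_2$ the point $s_1$ replaces $\ell_j$). **One-sided maps.** For $\lambda\in\rho(H^{\Omega_1}_{\Gamma_1})$, $M_1(\lambda)=-u'(s_1,\lambda)/u(s_1,\lambda)$, equivalently $M_1(\lambda)f=-u'(s_1)$, where $u$ is the unique solution of $(H^{\Omega_1}-\lambda)u=0$ with $u(s_1)=f$ that satisfies the $\Gamma_1$ condition at $\ell_j$. For $\lambda\in\rho(H^{\Omega_2}_{\Gamma_2})$, $M_2(\lambda)f=u_j'(s_1)$, where $\vec u$ is the unique solution of $(H^{\Omega_2}-\lambda)\vec u=\vec 0$ with $u_j(s_1)=f$ that satisfies all other $\Gamma_2$ conditions. The two-sided map is $M_1+M_2$. *)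

(* Defs.v *)
From HB Require Import structures.
From mathcomp Require Import all_boot all_order all_algebra.
From mathcomp Require Import all_classical all_reals all_analysis.
From mathcomp Require Export complex.
Set Implicit Arguments.
Unset Strict Implicit.
Unset Printing Implicit Defensive.
Import Order.TTheory GRing.Theory Num.Theory.
Import numFieldNormedType.Exports.
Local Open Scope classical_set_scope.
Local Open Scope complex_scope.
Local Open Scope ring_scope.

Definition cabs (R : realType) (z : R[i]) : R := Normc.normc z.

Definition absolutely_continuous (R : realType) (a b : R) (f : R -> R[i]) : Prop :=
  forall e : R, 0 < e -> exists2 d : R, 0 < d &
    forall (m : nat) (p q : 'I_m -> R),
      (forall k, [/\ a <= p k, p k <= q k & q k <= b]) ->
      (forall k k', k != k' -> q k <= p k' \/ q k' <= p k) ->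
      \sum_(k < m) (q k - p k) < d ->
      \sum_(k < m) cabs (f (q k) - f (p k)) < e.

(* Derivative on the closed interval [a, b], one-sided at the two endpoints. *)
Definition deriv_on (R : realType) (a b : R) (f df : R -> R[i]) : Prop :=
  forall x : R, a <= x <= b ->
    ((fun y : R => complex.Re ((f y - f x) / (y - x)%:C))
       @ within [set` `[a, b]] (x^') --> complex.Re (df x)) /\
    ((fun y : R => complex.Im ((f y - f x) / (y - x)%:C))
       @ within [set` `[a, b]] (x^') --> complex.Im (df x)).

Definition cderive_at (R : realType) (f : R -> R[i]) (x : R) (d : R[i]) : Prop :=
  is_derive x 1 (fun y : R => complex.Re (f y) : R) (complex.Re d) /\
  is_derive x 1 (fun y : R => complex.Im (f y) : R) (complex.Im d).

Definition in_L1 (R : realType) (a b : R) (f : R -> R[i]) : Prop :=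
  (@lebesgue_measure R).-integrable `]a, b[
     (fun x => (complex.Re (f x))%:E) /\
  (@lebesgue_measure R).-integrable `]a, b[
     (fun x => (complex.Im (f x))%:E).

Definition in_L2 (R : realType) (a b : R) (f : R -> R[i]) : Prop :=
  [/\ measurable_fun `]a, b[ (fun x : R => complex.Re (f x)),
      measurable_fun `]a, b[ (fun x : R => complex.Im (f x)) &
      (\int[@lebesgue_measure R]_(x in `]a, b[) ((cabs (f x)) ^+ 2)%:E < +oo)%E].

(* [du] is the derivative of [u]; both are absolutely continuous on the closed
   edge. *)
Definition regular (R : realType) (a b : R) (u du : R -> R[i]) : Prop :=
  [/\ absolutely_continuous a b u, absolutely_continuous a b du
    & deriv_on a b u du].

Definition schrodinger_ae (R : realType) (a b : R) (V u du w : R -> R[i]) : Prop :=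
  {ae @lebesgue_measure R, forall x : R, a < x < b ->
    exists2 ddu : R[i], cderive_at du x ddu & - ddu + V x * u x = w x}.

Definition edge_solution (R : realType) (a b : R) (V : R -> R[i]) (lambda : R[i])
    (u du : R -> R[i]) : Prop :=
  regular a b u du /\ schrodinger_ae a b V u du (fun x => lambda * u x).

(* The pair (u, u') for the solution u with u x0 = c and u' x0 = d; it is
   determined on [a, b] only. *)
Definition cauchy_solution (R : realType) (a b : R) (V : R -> R[i])
    (lambda : R[i]) (x0 : R) (c d : R[i]) : (R -> R[i]) * (R -> R[i]) :=
  xget ((fun _ => 0), (fun _ => 0))
    [set p | [/\ edge_solution a b V lambda p.1 p.2, p.1 x0 = c & p.2 x0 = d]].

(* Edge i is the interval [org i, tip i], the points [org i] being identified
   with the common vertex. *)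
Record star (R : realType) (n : nat) := Star {
  org : 'I_n -> R;
  tip : 'I_n -> R;
  pot : 'I_n -> R -> R[i] }.

Record bcond (R : realType) (n : nat) := BCond {
  alpha1 : 'M[R[i]]_n;
  alpha2 : 'M[R[i]]_n;
  beta1 : 'M[R[i]]_n;
  beta2 : 'M[R[i]]_n }.

Definition adjmx (R : realType) (m n : nat) (A : 'M[R[i]]_(m, n)) :
  'M[R[i]]_(n, m) := map_mx (@conjc R) A^T.

Definition self_adjoint_bc (R : realType) (n : nat) (G : bcond R n) : Prop :=
  [/\ \rank (row_mx (alpha1 G) (alpha2 G)) = n,
      \rank (row_mx (beta1 G) (beta2 G)) = n,
      alpha1 G *m adjmx (alpha2 G) = alpha2 G *m adjmx (alpha1 G) &
      beta1 G *m adjmx (beta2 G) = beta2 G *m adjmx (beta1 G)].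

Definition diagonal_ends (R : realType) (n : nat) (G : bcond R n) : Prop :=
  is_diag_mx (beta1 G) /\ is_diag_mx (beta2 G).

Definition at_pt (R : realType) (n : nat) (u : 'I_n -> R -> R[i]) (x : 'I_n -> R) :
  'cV[R[i]]_n := \col_i u i (x i).

Definition org_form (R : realType) (n : nat) (S : star R n) (G : bcond R n)
    (u du : 'I_n -> R -> R[i]) : 'cV[R[i]]_n :=
  alpha1 G *m at_pt u (org S) + alpha2 G *m at_pt du (org S).

Definition tip_form (R : realType) (n : nat) (S : star R n) (G : bcond R n)
    (u du : 'I_n -> R -> R[i]) : 'cV[R[i]]_n :=
  beta1 G *m at_pt u (tip S) + beta2 G *m at_pt du (tip S).

Definition star_solution (R : realType) (n : nat) (S : star R n) (lambda : R[i])
    (u du : 'I_n -> R -> R[i]) : Prop :=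
  forall i, edge_solution (org S i) (tip S i) (pot S i) lambda (u i) (du i).

Definition star_L2 (R : realType) (n : nat) (S : star R n)
    (f : 'I_n -> R -> R[i]) : Prop :=
  forall i, in_L2 (org S i) (tip S i) (f i).

Definition star_norm (R : realType) (n : nat) (S : star R n)
    (f : 'I_n -> R -> R[i]) : R :=
  Num.sqrt (\sum_(i < n)
    \int[@lebesgue_measure R]_(x in `]org S i, tip S i[) ((cabs (f i x)) ^+ 2)).

(* The graph of the operator: u is in the domain and is mapped to (the L^2
   class of) w. Elements of the domain are taken in their continuous
   representatives. *)
Definition star_op (R : realType) (n : nat) (S : star R n) (G : bcond R n)
    (u w : 'I_n -> R -> R[i]) : Prop :=
  exists du : 'I_n -> R -> R[i],
    [/\ forall i, regular (org S i) (tip S i) (u i) (du i),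
        org_form S G u du = 0 /\ tip_form S G u du = 0,
        star_L2 S w &
        forall i, schrodinger_ae (org S i) (tip S i) (pot S i) (u i) (du i) (w i)].

(* (H - lambda) u = f, as elements of L^2. *)
Definition star_op_shift (R : realType) (n : nat) (S : star R n) (G : bcond R n)
    (lambda : R[i]) (u f : 'I_n -> R -> R[i]) : Prop :=
  star_L2 S f /\ star_op S G u (fun i x => f i x + lambda * u i x).

(* The last clause is boundedness of the inverse. *)
Definition in_resolvent_set (R : realType) (n : nat) (S : star R n) (G : bcond R n)
    (lambda : R[i]) : Prop :=
  [/\ forall f, star_L2 S f -> exists u, star_op_shift S G lambda u f,
      forall u, star_op_shift S G lambda u (fun _ _ => 0) ->
        forall i, {ae @lebesgue_measure R, forall x : R,
          org S i < x < tip S i -> u i x = 0} &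
      exists K : R, forall u f, star_op_shift S G lambda u f ->
        star_norm S u <= K * star_norm S f].

(* Entry (k, m) of Y is a function on edge k; its derivative is the second
   component. *)
Definition evansY (R : realType) (n : nat) (S : star R n) (G : bcond R n)
    (lambda : R[i]) (k m : 'I_n) : (R -> R[i]) * (R -> R[i]) :=
  cauchy_solution (org S k) (tip S k) (pot S k) lambda (org S k)
    ((- adjmx (alpha2 G)) k m) (adjmx (alpha1 G) k m).

Definition evansZ (R : realType) (n : nat) (S : star R n) (G : bcond R n)
    (lambda : R[i]) (k m : 'I_n) : (R -> R[i]) * (R -> R[i]) :=
  cauchy_solution (org S k) (tip S k) (pot S k) lambda (tip S k)
    ((- adjmx (beta2 G)) k m) (adjmx (beta1 G) k m).

Definition on_star (R : realType) (n : nat) (S : star R n) (x : 'I_n -> R) : Prop :=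
  forall i, org S i <= x i <= tip S i.

(* The determinant evaluated at the point x of the graph; its value is the
   same for all x satisfying [on_star]. *)
Definition evans (R : realType) (n : nat) (S : star R n) (G : bcond R n)
    (x : 'I_n -> R) (lambda : R[i]) : R[i] :=
  \det (block_mx
    (\matrix_(k, m) (evansY S G lambda k m).1 (x k))
    (\matrix_(k, m) (evansZ S G lambda k m).1 (x k))
    (\matrix_(k, m) (evansY S G lambda k m).2 (x k))
    (\matrix_(k, m) (evansZ S G lambda k m).2 (x k))).

Definition star0 (R : realType) (n : nat) (l : 'I_n -> R) (V : 'I_n -> R -> R[i]) :
  star R n := Star (fun _ => 0) l V.

Definition star1 (R : realType) (n : nat) (l : 'I_n -> R) (V : 'I_n -> R -> R[i])
    (j : 'I_n) (s : R) : star R 1 :=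
  Star (fun _ => s) (fun _ => l j) (fun _ => V j).

Definition star2 (R : realType) (n : nat) (l : 'I_n -> R) (V : 'I_n -> R -> R[i])
    (j : 'I_n) (s : R) : star R n :=
  Star (fun _ => 0) (fun i => if i == j then s else l i) V.

Definition bcond1 (R : realType) (n : nat) (G : bcond R n) (j : 'I_n) : bcond R 1 :=
  BCond 1%:M 0 (beta1 G j j)%:M (beta2 G j j)%:M.

Definition set_entry (R : realType) (n : nat) (A : 'M[R[i]]_n) (j : 'I_n)
    (c : R[i]) : 'M[R[i]]_n :=
  \matrix_(i, k) (if (i == j) && (k == j) then c else A i k).

Definition bcond2 (R : realType) (n : nat) (G : bcond R n) (j : 'I_n) : bcond R n :=
  BCond (alpha1 G) (alpha2 G) (set_entry (beta1 G) j 1) (set_entry (beta2 G) j 0).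

Definition M1_solution (R : realType) (n : nat) (l : 'I_n -> R)
    (V : 'I_n -> R -> R[i]) (G : bcond R n) (j : 'I_n) (s : R) (lambda f : R[i]) :
    ('I_1 -> R -> R[i]) * ('I_1 -> R -> R[i]) :=
  xget ((fun _ _ => 0), (fun _ _ => 0))
    [set p | [/\ star_solution (star1 l V j s) lambda p.1 p.2,
                 tip_form (star1 l V j s) (bcond1 G j) p.1 p.2 = 0
               & p.1 ord0 s = f]].

Definition M1 (R : realType) (n : nat) (l : 'I_n -> R) (V : 'I_n -> R -> R[i])
    (G : bcond R n) (j : 'I_n) (s : R) (lambda f : R[i]) : R[i] :=
  - (M1_solution l V G j s lambda f).2 ord0 s.

(* As beta1 and beta2 are diagonal, row i of the condition at the tips is the
   condition at the end of edge i; row j, the Dirichlet condition at s, is left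
   out and replaced by u_j(s) = f. *)
Definition M2_solution (R : realType) (n : nat) (l : 'I_n -> R)
    (V : 'I_n -> R -> R[i]) (G : bcond R n) (j : 'I_n) (s : R) (lambda f : R[i]) :
    ('I_n -> R -> R[i]) * ('I_n -> R -> R[i]) :=
  xget ((fun _ _ => 0), (fun _ _ => 0))
    [set p | [/\ star_solution (star2 l V j s) lambda p.1 p.2,
                 org_form (star2 l V j s) (bcond2 G j) p.1 p.2 = 0,
                 forall i, i != j ->
                   tip_form (star2 l V j s) (bcond2 G j) p.1 p.2 i ord0 = 0
               & p.1 j s = f]].

Definition M2 (R : realType) (n : nat) (l : 'I_n -> R) (V : 'I_n -> R -> R[i])
    (G : bcond R n) (j : 'I_n) (s : R) (lambda f : R[i]) : R[i] :=
  (M2_solution l V G j s lambda f).2 j s.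

Definition two_sided_map (R : realType) (n : nat) (l : 'I_n -> R)
    (V : 'I_n -> R -> R[i]) (G : bcond R n) (j : 'I_n) (s : R)
    (lambda f : R[i]) : R[i] :=
  M1 l V G j s lambda f + M2 l V G j s lambda f.

(* Main.v *)
Require Import Defs.
From mathcomp Require Import all_boot all_order all_algebra.
From mathcomp Require Import all_classical all_reals all_analysis.
From mathcomp Require Import measurable_realfun ring lra.
Import Order.TTheory GRing.Theory Num.Theory.
Import numFieldNormedType.Exports.
Set Implicit Arguments.
Unset Strict Implicit.
Unset Printing Implicit Defensive.
Local Open Scope classical_set_scope.
Local Open Scope complex_scope.
Local Open Scope ring_scope.

(* As [Z] is diagonal, the Evans determinant equals [det F] with
   [F = Z' Y - Z Y'], whose entries are Wronskians, hence constants. The matrix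
   [F2] of the second subgraph differs from [F] only in row [j], which is
   [Y_j (s)] instead of [z' Y_j (s) - z Y_j' (s)], where [z] is the solution on
   the first subgraph satisfying the condition at the tip; moreover
   [E1 = - z (s)]. Solutions satisfying the condition at the origin are the
   columns [Y c], and [u_j (s) = f] together with the tip conditions reads
   [F2 c = f e_j]; expanding [det F] along row [j] and using Cramer's rule gives
   [det F * f = det F2 * (z' f - z M2 f)], which is the claim since
   [M1 f = - f z' / z]. A zero of [E1] or [E2] would provide an eigenfunction.

   For potentials in L^1, solutions are obtained as fixed points of a Volterra
   operator, which is a contraction for the sup norm with an exponential weight,
   and the constancy of Wronskians follows from the fact that an absolutely
   continuous function with almost everywhere vanishing derivative is constant. *)

(** * Primitives of integrable functions *)

(** [cauchy_solution], [M1_solution] and [M2_solution] select some element of a set and fall back on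
    zero when the set is empty. Each use therefore requires an existence proof, and every identity
    is shown for whichever solution is selected. As [V] is only integrable, u'' exists merely almost
    everywhere, so the Wronskian identity cannot rest on the mean value theorem; u' exists at every
    point, since u is a primitive of a continuous function. Integration is carried out for real
    functions: the complex equation becomes a coupled system for Re u and Im u. The coefficients are
    cut off to zero outside the edge, which lets every integral start at -oo and every function live
    on the whole line. Uniqueness does not come from a Gronwall estimate but from Wronskians with a
    fundamental system, and these work for Cauchy data at any point of the edge. *)

Definition primitive (R : realType) (h : R -> R) (x : R) : R :=
  \int[@lebesgue_measure R]_(t in `]-oo, x]) h t.

Definition summable (R : realType) (h : R -> R) : Prop :=
  (@lebesgue_measure R).-integrable setT (EFin \o h).

Lemma summableW (R : realType) (h : R -> R) (i : interval R) :
  summable h -> (@lebesgue_measure R).-integrable [set` i] (EFin \o h).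
Proof. by move=> ih; apply: integrableS ih. Qed.

Lemma summable_measurable (R : realType) (h : R -> R) :
  summable h -> measurable_fun setT h.
Proof. by move=> /integrableP[/measurable_EFinP]. Qed.

Lemma le_summable (R : realType) (h w : R -> R) : measurable_fun setT h ->
  summable w -> (forall t, `|h t| <= w t) -> summable h.
Proof.
move=> mh iw hw; apply: (le_integrable measurableT _ _ iw).
  exact/measurable_EFinP.
move=> t _ /=; rewrite lee_fin (le_trans (hw t))//.
exact: ler_norm.
Qed.

Lemma summable_norm (R : realType) (h : R -> R) :
  summable h -> summable (fun t => `|h t|).
Proof. by move=> ih; exact: (integrable_norm ih). Qed.

Lemma summableD (R : realType) (h k : R -> R) :
  summable h -> summable k -> summable (fun t => h t + k t).
Proof.
by move=> ih ik; rewrite /summable; have := integrableD measurableT ih ik.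
Qed.

Lemma summableB (R : realType) (h k : R -> R) :
  summable h -> summable k -> summable (fun t => h t - k t).
Proof.
by move=> ih ik; rewrite /summable; have := integrableB measurableT ih ik.
Qed.

Lemma summableZ (R : realType) (c : R) (h : R -> R) :
  summable h -> summable (fun t => c * h t).
Proof.
by move=> ih; rewrite /summable; have := integrableZl measurableT c ih.
Qed.

Lemma primitiveB (R : realType) (h : R -> R) (x y : R) : summable h -> x <= y ->
  primitive h y - primitive h x = \int[@lebesgue_measure R]_(t in `]x, y]) h t.
Proof.
by move=> ih xy; rewrite /primitive Rintegral_itvB//; exact: summableW.
Qed.

Lemma le_primitive (R : realType) (h k : R -> R) (x : R) :
  summable h -> summable k -> (forall t, t <= x -> h t <= k t) ->
  primitive h x <= primitive k x.
Proof.
by move=> ih ik hk; apply: le_Rintegral => //; exact: summableW.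
Qed.

Lemma ler_norm_primitive (R : realType) (h : R -> R) (x : R) : summable h ->
  `|primitive h x| <= primitive (fun t => `|h t|) x.
Proof. by move=> ih; apply: le_normr_Rintegral => //; exact: summableW. Qed.

Lemma le_primitive_integral (R : realType) (h : R -> R) (x : R) :
  summable h -> (forall t, 0 <= h t) ->
  primitive h x <= \int[@lebesgue_measure R]_t h t.
Proof.
move=> ih h0; rewrite /primitive Rintegral_mkcond.
apply: le_Rintegral => //.
  by rewrite -restrict_EFin; apply/integrable_restrict; rewrite ?setTI//; exact: summableW.
by move=> t _; rewrite patchE; case: ifP.
Qed.

Lemma primitiveZ (R : realType) (c : R) (h : R -> R) (x : R) : summable h ->
  primitive (fun t => c * h t) x = c * primitive h x.
Proof. by move=> ih; apply: RintegralZl => //; exact: summableW. Qed.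

Lemma primitive_sub (R : realType) (h k : R -> R) (x : R) :
  summable h -> summable k ->
  primitive (fun t => h t - k t) x = primitive h x - primitive k x.
Proof. by move=> ih ik; apply: RintegralB => //; exact: summableW. Qed.

Lemma ler_norm_primitiveB (R : realType) (h : R -> R) (x y : R) :
  summable h -> x <= y ->
  `|primitive h y - primitive h x| <=
  primitive (fun t => `|h t|) y - primitive (fun t => `|h t|) x.
Proof.
move=> ih xy; rewrite !primitiveB//; last exact: summable_norm.
by apply: le_normr_Rintegral => //; exact: summableW.
Qed.

(** Half-open intervals are used because neighbours in the definition of absolute continuity may
    share an endpoint. *)
Lemma trivIset_itv (R : realType) (m : nat) (p q : 'I_m -> R) :
  (forall k k', k != k' -> q k <= p k' \/ q k' <= p k) ->
  trivIset setT (fun k => `]p k, q k]%classic).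
Proof.
move=> dis k k' _ _ [t [/=]]; rewrite !in_itv /= => /andP[a1 a2] /andP[b1 b2].
apply/eqP; apply: contraT => /dis[|] c; lra.
Qed.

Lemma lebesgue_measure_bigsetU_itv (R : realType) (m : nat) (p q : 'I_m -> R) :
  (forall k, p k <= q k) -> (forall k k', k != k' -> q k <= p k' \/ q k' <= p k) ->
  lebesgue_measure (\big[setU/set0]_(k < m) `]p k, q k]%classic) =
  (\sum_(k < m) (q k - p k))%:E.
Proof.
move=> pq dis; rewrite (measure_bigsetU_ord lebesgue_measure) //; last first.
  by move=> k k' _ _; exact: trivIset_itv.
rewrite -sumEFin; apply: eq_bigr => k _.
rewrite [LHS](lebesgue_measure_itv `]p k, q k]) /= lte_fin; case: ltP => //=.
move=> qp; have -> : q k = p k by apply/eqP; rewrite eq_le qp pq.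
by rewrite subrr.
Qed.

(** Small measure forces a small integral of [|h|]; this is applied to the union of the intervals.
    The primitive of [|h|] is the right quantity to bound, as its increments dominate those of
    [primitive h]. *)
Lemma primitive_abs_cont (R : realType) (h : R -> R) (e : R) :
  summable h -> 0 < e -> exists2 d : R, 0 < d &
    forall (m : nat) (p q : 'I_m -> R),
      (forall k, p k <= q k) ->
      (forall k k', k != k' -> q k <= p k' \/ q k' <= p k) ->
      \sum_(k < m) (q k - p k) < d ->
      \sum_(k < m) (primitive (fun t => `|h t|) (q k)
                    - primitive (fun t => `|h t|) (p k)) < e.
Proof.
move=> ih e0.
have [d [d0 dP]] := integral_normr_continuous ih e0; exists d => // m p q pq dis sd.
pose A := \big[setU/set0]_(k < m) `]p k, q k]%classic.
have tr : trivIset [set` (index_enum 'I_m)] (fun k => `]p k, q k]%classic).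
  by move=> k k' _ _; exact: trivIset_itv.
have mA : measurable A by apply: bigsetU_measurable.
have inh : summable (fun t => `|h t|) by exact: summable_norm.
have muA := lebesgue_measure_bigsetU_itv pq dis.
have : \int[lebesgue_measure]_(x in A) `|h x| < e.
  apply: dP => //; apply: (@le_lt_trans _ _ (\sum_(k < m) (q k - p k))%:E).
    by rewrite -muA.
  by rewrite lte_fin.
rewrite /Rintegral integral_bigsetU_EFin//; last 2 first.
- exact: index_enum_uniq.
- by apply/measurable_EFinP; apply: measurable_funTS; exact: summable_measurable.
rewrite (_ : (\sum_i _)%E = (\sum_(k < m) (primitive (fun t => `|h t|) (q k)
    - primitive (fun t => `|h t|) (p k)))%:E) //.
rewrite -sumEFin; apply: eq_bigr => k _; rewrite primitiveB// /Rintegral fineK//.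
by apply: integrable_fin_num => //; exact: summableW.
Qed.

Lemma primitive_norm_unif (R : realType) (h : R -> R) (e : R) :
  summable h -> 0 < e -> exists2 d : R, 0 < d & forall x y, `|y - x| < d ->
    `|primitive (fun t => `|h t|) y - primitive (fun t => `|h t|) x| < e.
Proof.
move=> ih e0; have [d d0 dP] := primitive_abs_cont ih e0; exists d => // x y.
wlog xy : x y / x <= y => [wl|].
  case: (leP x y) => [/wl//|/ltW /wl]; rewrite distrC => H ?.
  by rewrite distrC H.
rewrite ger0_norm ?subr_ge0// => yxd.
rewrite ger0_norm ?subr_ge0; last first.
  rewrite -subr_ge0 primitiveB//; last exact: summable_norm.
  by apply: Rintegral_ge0.
have := dP 1%N (fun=> x) (fun=> y); rewrite !big_ord1; apply => //.
by move=> k k'; rewrite !ord1 eqxx.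
Qed.

Lemma ler_dist_primitive (R : realType) (h : R -> R) (x y : R) : summable h ->
  `|primitive h y - primitive h x| <=
  `|primitive (fun t => `|h t|) y - primitive (fun t => `|h t|) x|.
Proof.
move=> ih; wlog xy : x y / x <= y => [wl|].
  case: (leP x y) => [/wl//|/ltW /wl]; rewrite distrC => H.
  by rewrite (le_trans H)// distrC.
by rewrite (le_trans (ler_norm_primitiveB ih xy))// ler_norm.
Qed.

(* [int_(-oo)^x (x - t) h t dt], split so that its increments are visible. *)
Definition volterra (R : realType) (h : R -> R) (x : R) : R :=
  x * primitive h x - primitive (fun t => t * h t) x.

Lemma volterraE (R : realType) (h : R -> R) (x : R) :
  summable h -> summable (fun t => t * h t) ->
  volterra h x = primitive (fun t => (x - t) * h t) x.
Proof.
move=> ih ith; rewrite /volterra -primitiveZ// -primitive_sub//; last exact: summableZ.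
by congr (primitive _ x); apply/funext => t; rewrite mulrBl.
Qed.

(** A first-order Taylor estimate: the factor next to [|y - x|] tends to 0 by uniform continuity of
    the primitive of [|h|], so [volterra h] is differentiable at every point although [h] is only
    integrable. *)
Lemma volterra_increment (R : realType) (h : R -> R) (x y : R) :
  summable h -> summable (fun t => t * h t) ->
  `|volterra h y - volterra h x - (y - x) * primitive h x| <=
  `|y - x| * `|primitive (fun t => `|h t|) y - primitive (fun t => `|h t|) x|.
Proof.
move=> ih ith.
(* The left side is the integral of [(c - t) * h t] over []u, v]], where [|c - t| <= v - u]. Both
   uses take [c = y], the right endpoint if [x <= y] and the left one otherwise. *)
have key u v c : u <= c -> c <= v ->
    `|c * (primitive h v - primitive h u) -
      (primitive (fun t => t * h t) v - primitive (fun t => t * h t) u)| <=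
    (v - u) * (primitive (fun t => `|h t|) v - primitive (fun t => `|h t|) u).
  move=> uc cv; have uv := le_trans uc cv.
  have inh := summable_norm ih.
  have ich := summableZ c ih.
  rewrite !primitiveB// -RintegralZl//; last exact: summableW.
  rewrite -RintegralB//; [|exact: summableW..].
  rewrite -RintegralZl//; last exact: summableW.
  have ib := summableB ich ith.
  apply: (le_trans (le_normr_Rintegral _ _)) => //; first exact: summableW.
  apply: le_Rintegral => //.
  - exact: (summableW _ (summable_norm ib)).
  - exact: (summableW _ (summableZ _ inh)).
  move=> t /=; rewrite in_itv /= => /andP[ut tv].
  by rewrite -mulrBl normrM ler_wpM2r// ler_norml; lra.
have -> : volterra h y - volterra h x - (y - x) * primitive h x =
    y * (primitive h y - primitive h x) -
      (primitive (fun t => t * h t) y - primitive (fun t => t * h t) x).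
  by rewrite /volterra; ring.
case: (leP x y) => xy.
  rewrite (ger0_norm (_ : 0 <= y - x)) ?subr_ge0//.
  by apply: (le_trans (key x y y _ _)) => //; rewrite ler_wpM2l ?subr_ge0 ?ler_norm.
rewrite (distrC y x) (ger0_norm (_ : 0 <= x - y)) ?subr_ge0 ?(ltW xy)//.
rewrite (distrC (primitive (fun t => `|h t|) y)).
apply: (le_trans _ (ler_wpM2l _ (ler_norm _))); last by rewrite subr_ge0 ltW.
have := key y x y (lexx y) (ltW xy); rewrite -normrN; congr (`| _ | <= _).
by ring.
Qed.

Lemma is_derive_volterra (R : realType) (h : R -> R) (x : R) :
  summable h -> summable (fun t => t * h t) ->
  is_derive x 1 (volterra h) (primitive h x).
Proof.
move=> ih ith.
have H : (fun t : R => t^-1 *: (volterra h (t *: (1:R) + x) - volterra h x)) @ 0^'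
    --> primitive h x.
  apply/cvgrPdist_lt => e e0.
  have [d d0 dP] := primitive_norm_unif ih e0.
  near=> t.
  have t0 : t != 0 by near: t; exact: nbhs_dnbhs_neq.
  have td : `|t| < d.
    near: t; apply: dnbhs0_lt => //.
  rewrite /= distrC.
  have -> : t^-1 *: (volterra h (t *: 1 + x) - volterra h x) - primitive h x =
     t^-1 * (volterra h (t + x) - volterra h x - t * primitive h x).
    by rewrite /GRing.scale /= mulr1; field.
  have := volterra_increment x (t + x) ih ith; rewrite addrK => le1.
  rewrite normrM normfV.
  rewrite mulrC ltr_pdivrMr ?normr_gt0//.
  rewrite (le_lt_trans le1)// mulrC ltr_pM2r ?normr_gt0// dP//.
  by rewrite addrK.
by apply: DeriveDef; [exact: cvgP H|exact: cvg_lim H].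
Unshelve. all: end_near. Qed.

(* Since [(x - t) e^(- K (x - t)) <= 1 / K], a large weight [K] makes the operator
   contract, whatever the length of the edge. *)
Lemma volterra_weighted (R : realType) (h w : R -> R) (a D K x : R) :
  summable h -> summable (fun t => t * h t) -> summable w ->
  0 < K -> 0 <= D -> (forall t, 0 <= w t) ->
  (forall t, `|h t| <= w t * (D * expR (K * (t - a)))) ->
  `|volterra h x| <= D / K * expR (K * (x - a)) * primitive w x.
Proof.
move=> ih ith iw K0 D0 w0 hw.
have ixh : summable (fun t => (x - t) * h t).
  have := summableB (summableZ x ih) ith; congr summable.
  by apply/funext => t /=; rewrite mulrBl.
rewrite volterraE//; apply: (le_trans (ler_norm_primitive _ ixh)).
rewrite -primitiveZ//; apply: le_primitive; [exact: summable_norm|exact: summableZ|].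
move=> t tx; rewrite normrM (ger0_norm (_ : 0 <= x - t)) ?subr_ge0//.
apply: (le_trans (ler_wpM2l _ (hw t))); first by rewrite subr_ge0.
rewrite mulrCA [leRHS]mulrC ler_wpM2l//.
rewrite mulrCA -mulrA ler_wpM2l//.
have -> : K * (x - a) = K * (x - t) + K * (t - a) by ring.
rewrite expRD mulrA ler_wpM2r ?expR_ge0//.
rewrite mulrC ler_pdivlMr// mulrC.
by apply: (le_trans _ (expR_ge1Dx _)); rewrite lerDr.
Qed.

(** * Fixed points of the Volterra operator *)

(** The tail of the geometric series is [r k], twice the current bound. Subtracting it from [u]
    gives a nondecreasing sequence and adding it a nonincreasing one, so monotone convergence yields
    the limit and the error bound together. *)
Lemma geometric_increments_cvg (R : realType) (u : nat -> R) (C : R) :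
  (forall k, `|u k.+1 - u k| <= C * (1 / 2) ^+ k) ->
  exists2 l : R, u @ \oo --> l & forall k, `|l - u k| <= C * 2 * (1 / 2) ^+ k.
Proof.
move=> uC; have C0 : 0 <= C.
  by have := uC 0%N; rewrite expr0 mulr1; apply: le_trans.
pose r (k : nat) : R := C * 2 * (1 / 2) ^+ k.
have r0 k : 0 <= r k by rewrite /r !mulr_ge0// exprn_ge0//; lra.
have rS k : r k.+1 = r k - C * (1 / 2) ^+ k by rewrite /r exprS; field.
have uS k : u k - C * (1 / 2) ^+ k <= u k.+1 <= u k + C * (1 / 2) ^+ k.
  by have := uC k; rewrite ler_norml; lra.
have lo : nondecreasing_seq (fun k => u k - r k).
  by apply/nondecreasing_seqP => k; rewrite rS; have := uS k; lra.
have hi : nonincreasing_seq (fun k => u k + r k).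
  by apply/nonincreasing_seqP => k; rewrite rS; have := uS k; lra.
have cr : r @ \oo --> (0 : R).
  have -> : (0 : R) = C * 2 * 0 by rewrite mulr0.
  apply: cvgMl_tmp; apply: cvg_expr; rewrite ger0_norm; lra.
have clo : cvgn (fun k => u k - r k).
  apply: nondecreasing_is_cvgn => //; exists (u 0%N + r 0%N) => _ [k _ <-].
  by have := hi 0%N k (leq0n k); have := r0 k; lra.
pose l := limn (fun k => u k - r k).
have ul : u @ \oo --> l.
  have -> : u = (fun k => u k - r k) \+ r by apply/funext => k /=; rewrite subrK.
  by rewrite -[l]addr0; exact: cvgD.
exists l => // k; rewrite -/(r k) ler_norml; apply/andP; split.
  have := nondecreasing_cvgn_le lo clo k; rewrite -/l; lra.
have cu : (fun k => u k + r k) @ \oo --> l.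
  by rewrite -[l]addr0; exact: cvgD.
have := nonincreasing_cvgn_ge hi (cvgP _ cu) k.
rewrite (cvg_lim _ cu)//; lra.
Qed.

Lemma geometric_bound_eq0 (R : realType) (z C : R) :
  (forall k, `|z| <= C * (1 / 2) ^+ k) -> z = 0.
Proof.
move=> zC; apply/eqP; rewrite -normr_le0.
have c : (fun k : nat => C * (1 / 2 : R) ^+ k) @ \oo --> (0 : R).
  have -> : (0 : R) = C * 0 by rewrite mulr0.
  apply: cvgMl_tmp; apply: cvg_expr; rewrite ger0_norm; lra.
by apply: (cvgr_to_ge c); exact: nearW.
Qed.

(** A class that is stable under products, differences and the limit below. Measurability passes to
    pointwise limits; boundedness is asked on the open edge only, because the affine data are
    unbounded on the line while the coefficients vanish off the edge. *)
Definition nice (R : realType) (a b : R) (f : R -> R) : Prop :=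
  measurable_fun setT f /\ exists M, forall t, a < t < b -> `|f t| <= M.

Lemma continuous_nice (R : realType) (a b : R) (f : R -> R) :
  continuous f -> nice a b f.
Proof.
move=> cf; split; first exact: continuous_measurable_fun.
have : compact (f @` `[a, b]).
  by apply: continuous_compact; [exact: continuous_subspaceT|exact: segment_compact].
move=> /compact_bounded [M [_ MP]]; exists (M + 1) => t /andP[at1 tb].
apply: (MP (M + 1)); first by rewrite ltrDl.
by exists t => //=; rewrite in_itv /= !ltW.
Qed.

Lemma niceM (R : realType) (a b : R) (f g : R -> R) :
  nice a b f -> nice a b g -> nice a b (fun t => f t * g t).
Proof.
move=> [mf [M fM]] [mg [N gN]]; split; first exact: measurable_funM.
exists (M * N) => t tab; rewrite normrM; apply: ler_pM => //; [exact: fM|exact: gN].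
Qed.

Lemma nice_sub (R : realType) (a b : R) (f g : R -> R) :
  nice a b f -> nice a b g -> nice a b (fun t => f t - g t).
Proof.
move=> [mf [M fM]] [mg [N gN]]; split; first exact: measurable_funB.
exists (M + N) => t tab; rewrite (le_trans (ler_normB _ _))//.
by apply: lerD; [exact: fM|exact: gN].
Qed.

Lemma summable_nice (R : realType) (a b : R) (A f : R -> R) :
  summable A -> (forall t, ~~ (a < t < b) -> A t = 0) -> nice a b f ->
  summable (fun t => A t * f t).
Proof.
move=> iA A0 [mf [M fM]].
apply: (@le_summable _ _ (fun t => M * `|A t|)).
- by apply: measurable_funM => //; exact: summable_measurable.
- exact/summableZ/summable_norm.
move=> t; have [tab|tab] := boolP (a < t < b); last first.
  by rewrite A0// mul0r normr0 mulr0.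
by rewrite normrM mulrC ler_wpM2r// fM.
Qed.

Section fixpoint.
Variables (R : realType) (a b : R) (A B g1 g2 : R -> R).
Hypotheses (iA : summable A) (iB : summable B).
Hypotheses (A0 : forall t, ~~ (a < t < b) -> A t = 0)
  (B0 : forall t, ~~ (a < t < b) -> B t = 0).
Hypotheses (cg1 : continuous g1) (cg2 : continuous g2).

(** Real and imaginary parts of (A + iB)(p + iq). In the application A + iB is the cut-off of
    [V - lambda], p + iq is the solution and g1 + i g2 is the affine function with the prescribed
    data. *)
Let h1 (p q : R -> R) t := A t * p t - B t * q t.
Let h2 (p q : R -> R) t := B t * p t + A t * q t.

Let summable_h1 p q : nice a b p -> nice a b q -> summable (h1 p q).
Proof.
by move=> np nq; apply: summableB;
  [exact: (summable_nice iA A0)|exact: (summable_nice iB B0)].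
Qed.

Let summable_h2 p q : nice a b p -> nice a b q -> summable (h2 p q).
Proof.
by move=> np nq; apply: summableD;
  [exact: (summable_nice iB B0)|exact: (summable_nice iA A0)].
Qed.

Let nice_id : nice a b (fun t : R => t).
Proof. by apply: continuous_nice => t. Qed.

Let summable_th1 p q : nice a b p -> nice a b q -> summable (fun t => t * h1 p q t).
Proof.
move=> np nq; have := summable_h1 (niceM nice_id np) (niceM nice_id nq).
by congr summable; apply/funext => t; rewrite /h1; ring.
Qed.

Let summable_th2 p q : nice a b p -> nice a b q -> summable (fun t => t * h2 p q t).
Proof.
move=> np nq; have := summable_h2 (niceM nice_id np) (niceM nice_id nq).
by congr summable; apply/funext => t; rewrite /h2; ring.
Qed.

Lemma continuous_volterra h : summable h -> summable (fun t => t * h t) ->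
  continuous (@volterra R h).
Proof.
move=> ih ith x; have [+ _] := is_derive_volterra x ih ith.
by move=> /derivable1_diffP/differentiable_continuous.
Qed.

Let step (s : (R -> R) * (R -> R)) : (R -> R) * (R -> R) :=
  (fun x => g1 x + volterra (h1 s.1 s.2) x, fun x => g2 x + volterra (h2 s.1 s.2) x).

Let P k := iter k step (g1, g2).

Let P_cont k : continuous (P k).1 /\ continuous (P k).2.
Proof.
elim: k => [//|k [c1 c2]].
have n1 := continuous_nice a b c1; have n2 := continuous_nice a b c2.
split => x /=.
  apply: cvgD; first exact: cg1.
  exact: (continuous_volterra (summable_h1 n1 n2) (summable_th1 n1 n2)).
apply: cvgD; first exact: cg2.
exact: (continuous_volterra (summable_h2 n1 n2) (summable_th2 n1 n2)).
Qed.

Let P_nice k : nice a b (P k).1 /\ nice a b (P k).2.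
Proof. by have [c1 c2] := P_cont k; split; exact: continuous_nice. Qed.

(** With [K = 2 * W + 1] the contraction factor [W / K] is below 1/2; the summand 1 keeps [K]
    positive when both coefficients vanish almost everywhere. *)
Let w t := `|A t| + `|B t|.
Let W := \int[@lebesgue_measure R]_t w t.
Let K := 2 * W + 1.
Let E x := expR (K * (x - a)).

Let w_ge0 t : 0 <= w t. Proof. by rewrite addr_ge0. Qed.
Let iw : summable w. Proof. by apply: summableD; exact: summable_norm. Qed.
Let W_ge0 : 0 <= W. Proof. by apply: Rintegral_ge0. Qed.
Let K_gt0 : 0 < K. Proof. by rewrite /K; have := W_ge0; lra. Qed.
Let E_gt0 x : 0 < E x. Proof. exact: expR_gt0. Qed.

Let contraction (h : R -> R) D x : summable h -> summable (fun t => t * h t) -> 0 <= D ->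
  (forall t, `|h t| <= w t * (D * E t)) -> `|volterra h x| <= D / 2 * E x.
Proof.
move=> ih ith D0 hw.
apply: (le_trans (volterra_weighted x ih ith iw K_gt0 D0 w_ge0 hw)).
rewrite mulrAC ler_wpM2r ?(ltW (E_gt0 x))// -mulrA ler_wpM2l//.
rewrite mulrC ler_pdivrMr//.
apply: (le_trans (le_primitive_integral x iw w_ge0)); rewrite -/W /K; lra.
Qed.

Let contraction1 p q D x : nice a b p -> nice a b q -> 0 <= D ->
  (forall t, a < t < b -> `|p t| <= D * E t /\ `|q t| <= D * E t) ->
  `|volterra (h1 p q) x| <= D / 2 * E x.
Proof.
move=> np nq D0 pq; apply: contraction => //; [exact: summable_h1|exact: summable_th1|].
move=> t; have [tab|tab] := boolP (a < t < b); last first.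
  by rewrite /h1 /w A0// B0// !mul0r subrr normr0 addr0 mul0r.
have [pt qt] := pq t tab.
rewrite (le_trans (ler_normB _ _))// !normrM /w mulrDl.
by apply: lerD; rewrite ler_wpM2l.
Qed.

Let contraction2 p q D x : nice a b p -> nice a b q -> 0 <= D ->
  (forall t, a < t < b -> `|p t| <= D * E t /\ `|q t| <= D * E t) ->
  `|volterra (h2 p q) x| <= D / 2 * E x.
Proof.
move=> np nq D0 pq; apply: contraction => //; [exact: summable_h2|exact: summable_th2|].
move=> t; have [tab|tab] := boolP (a < t < b); last first.
  by rewrite /h2 /w A0// B0// !mul0r addr0 normr0 addr0 mul0r.
have [pt qt] := pq t tab.
rewrite (le_trans (ler_normD _ _))// !normrM /w mulrDl addrC.
by apply: lerD; rewrite ler_wpM2l.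
Qed.

Let volterraB (h k : R -> R) x : summable h -> summable (fun t => t * h t) ->
  summable k -> summable (fun t => t * k t) ->
  volterra h x - volterra k x = volterra (fun t => h t - k t) x.
Proof.
move=> ih ith ik itk; rewrite /volterra.
rewrite (_ : (fun t => t * (h t - k t)) = (fun t => t * h t - t * k t)); last first.
  by apply/funext => t; rewrite mulrBr.
rewrite !primitive_sub//; ring.
Qed.

Let diff1 p q p' q' x : nice a b p -> nice a b q -> nice a b p' -> nice a b q' ->
  volterra (h1 p q) x - volterra (h1 p' q') x =
  volterra (h1 (fun t => p t - p' t) (fun t => q t - q' t)) x.
Proof.
move=> np nq np' nq'; rewrite volterraB;
  [|exact: summable_h1|exact: summable_th1|exact: summable_h1|exact: summable_th1].
by congr (volterra _ x); apply/funext => t; rewrite /h1; ring.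
Qed.

Let diff2 p q p' q' x : nice a b p -> nice a b q -> nice a b p' -> nice a b q' ->
  volterra (h2 p q) x - volterra (h2 p' q') x =
  volterra (h2 (fun t => p t - p' t) (fun t => q t - q' t)) x.
Proof.
move=> np nq np' nq'; rewrite volterraB;
  [|exact: summable_h2|exact: summable_th2|exact: summable_h2|exact: summable_th2].
by congr (volterra _ x); apply/funext => t; rewrite /h2; ring.
Qed.

Let half_ge0 k : 0 <= (1 / 2 : R) ^+ k.
Proof. by apply: exprn_ge0; lra. Qed.

Let P_increment : exists2 C, 0 <= C & forall k x,
  `|(P k.+1).1 x - (P k).1 x| <= C * (1 / 2) ^+ k * E x /\
  `|(P k.+1).2 x - (P k).2 x| <= C * (1 / 2) ^+ k * E x.
Proof.
have [[_ [M1 M1P]] [_ [M2 M2P]]] := P_nice 0.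
(* On the edge both data are bounded by [C], hence by [C * E t], as [E] is at least 1 to the right
   of [a]. *)
pose C := `|M1| + `|M2|; have C0 : 0 <= C by rewrite addr_ge0.
exists C => //; elim=> [|k IH] x.
  have gC t : a < t < b -> `|g1 t| <= C * E t /\ `|g2 t| <= C * E t.
    move=> /[dup] tab /andP[ta _]; have E1 : 1 <= E t.
      apply: (le_trans _ (expR_ge1Dx _)); rewrite lerDl mulr_ge0 ?subr_ge0 ?ltW//.
    have := M1P t tab; have := M2P t tab => /= g2t g1t.
    have CE : C <= C * E t by rewrite ler_peMr.
    have := ler_norm M1; have := ler_norm M2.
    have := normr_ge0 M1; have := normr_ge0 M2.
    by move: CE; rewrite /C => *; split; lra.
  have [n1 n2] := P_nice 0; rewrite expr0 mulr1.
  have CE : C / 2 * E x <= C * E x.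
    by rewrite ler_wpM2r ?(ltW (E_gt0 x))//; lra.
  split; apply: (le_trans _ CE); rewrite /= addrC addKr.
    exact: contraction1.
  exact: contraction2.
have [n1 n2] := P_nice k; have [n1' n2'] := P_nice k.+1.
have D0 : 0 <= C * (1 / 2) ^+ k by rewrite mulr_ge0.
have -> : C * (1 / 2) ^+ k.+1 = C * (1 / 2) ^+ k / 2 by rewrite exprS; field.
split.
  rewrite [X in `|X|](_ : _ = volterra (h1 (P k.+1).1 (P k.+1).2) x -
    volterra (h1 (P k).1 (P k).2) x); last first.
    by rewrite /=; ring.
  rewrite diff1//; apply: contraction1 => //; exact: nice_sub.
rewrite [X in `|X|](_ : _ = volterra (h2 (P k.+1).1 (P k.+1).2) x -
    volterra (h2 (P k).1 (P k).2) x); last first.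
  by rewrite /=; ring.
rewrite diff2//; apply: contraction2 => //; exact: nice_sub.
Qed.

(** The iterates converge pointwise with an error that is geometric relative to the weight [E]. One
    application of the contraction then bounds the residual of the limit by a geometric sequence in
    [k], so the residual is zero. *)
Lemma volterra_fixpoint : exists p q : R -> R,
  [/\ nice a b p, nice a b q,
      forall x, p x = g1 x + volterra (fun t => A t * p t - B t * q t) x &
      forall x, q x = g2 x + volterra (fun t => B t * p t + A t * q t) x].
Proof.
have [C C0 PC] := P_increment.
have /choice[p pP] x : exists l, (fun k => (P k).1 x) @ \oo --> l /\
    forall k, `|l - (P k).1 x| <= C * E x * 2 * (1 / 2) ^+ k.
  have [|l] := @geometric_increments_cvg R (fun k => (P k).1 x) (C * E x); last by exists l.
  by move=> k; rewrite mulrAC; have [] := PC k x.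
have /choice[q qP] x : exists l, (fun k => (P k).2 x) @ \oo --> l /\
    forall k, `|l - (P k).2 x| <= C * E x * 2 * (1 / 2) ^+ k.
  have [|l] := @geometric_increments_cvg R (fun k => (P k).2 x) (C * E x); last by exists l.
  by move=> k; rewrite mulrAC; have [] := PC k x.
have E_le t : a < t < b -> E t <= E b.
  by move=> /andP[_ tb]; rewrite /E ler_expR ler_pM2l// lerB// ltW.
have np : nice a b p.
  split.
    apply: (measurable_fun_cvg (fun k => proj1 (proj1 (P_nice k)))) => x _.
    exact: (pP x).1.
  have [[_ [M MP]] _] := P_nice 0; exists (M + C * E b * 2) => t tab.
  have := (pP t).2 0%N; rewrite expr0 mulr1 => H.
  rewrite -[p t](subrK (g1 t)) (le_trans (ler_normD _ _))// addrC lerD ?MP//.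
  by rewrite (le_trans H)// ler_wpM2r// ler_wpM2l// E_le.
have nq : nice a b q.
  split.
    apply: (measurable_fun_cvg (fun k => proj1 (proj2 (P_nice k)))) => x _.
    exact: (qP x).1.
  have [_ [_ [M MP]]] := P_nice 0; exists (M + C * E b * 2) => t tab.
  have := (qP t).2 0%N; rewrite expr0 mulr1 => H.
  rewrite -[q t](subrK (g2 t)) (le_trans (ler_normD _ _))// addrC lerD ?MP//.
  by rewrite (le_trans H)// ler_wpM2r// ler_wpM2l// E_le.
have near_fix k t : `|(P k).1 t - p t| <= C * 2 * (1 / 2) ^+ k * E t /\
    `|(P k).2 t - q t| <= C * 2 * (1 / 2) ^+ k * E t.
  rewrite distrC (distrC _ (q t)); have := (pP t).2 k; have := (qP t).2 k.
  by rewrite (_ : C * E t * 2 * _ = C * 2 * (1 / 2) ^+ k * E t) //; ring.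
have D0 k : 0 <= C * 2 * (1 / 2) ^+ k by rewrite !mulr_ge0.
exists p, q; split => // x; apply/eqP; rewrite -subr_eq0; apply/eqP.
  apply: (@geometric_bound_eq0 _ _ (C * 2 * E x)) => k.
  have [n1 n2] := P_nice k.
  (* The residual is the error of iterate [k.+1] plus the image of the error of iterate [k]; each
     contributes [C * (1 / 2) ^+ k * E x]. *)
  rewrite [X in `|X|](_ : _ = (p x - (P k.+1).1 x) +
    (volterra (h1 (P k).1 (P k).2) x - volterra (h1 p q) x)); last by rewrite /=; ring.
  rewrite diff1// (le_trans (ler_normD _ _))//.
  have b1 := (pP x).2 k.+1.
  have b2 : `|volterra (h1 (fun t => (P k).1 t - p t) (fun t => (P k).2 t - q t)) x|
      <= C * 2 * (1 / 2) ^+ k / 2 * E x.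
    by apply: contraction1 => //; exact: nice_sub.
  apply: (le_trans (lerD b1 b2)); rewrite exprS le_eqVlt; apply/orP; left; apply/eqP.
  by field.
apply: (@geometric_bound_eq0 _ _ (C * 2 * E x)) => k.
have [n1 n2] := P_nice k.
rewrite [X in `|X|](_ : _ = (q x - (P k.+1).2 x) +
  (volterra (h2 (P k).1 (P k).2) x - volterra (h2 p q) x)); last by rewrite /=; ring.
rewrite diff2// (le_trans (ler_normD _ _))//.
have b1 := (qP x).2 k.+1.
have b2 : `|volterra (h2 (fun t => (P k).1 t - p t) (fun t => (P k).2 t - q t)) x|
    <= C * 2 * (1 / 2) ^+ k / 2 * E x.
  by apply: contraction2 => //; exact: nice_sub.
apply: (le_trans (lerD b1 b2)); rewrite exprS le_eqVlt; apply/orP; left; apply/eqP.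
by field.
Qed.

End fixpoint.

(** * Absolutely continuous functions and existence of solutions *)

Notation Re := complex.Re.
Notation Im := complex.Im.

Lemma ReD (R : realType) (z w : R[i]) : Re (z + w) = Re z + Re w.
Proof. by case: z; case: w. Qed.
Lemma ImD (R : realType) (z w : R[i]) : Im (z + w) = Im z + Im w.
Proof. by case: z; case: w. Qed.
Lemma ReN (R : realType) (z : R[i]) : Re (- z) = - Re z.
Proof. by case: z. Qed.
Lemma ImN (R : realType) (z : R[i]) : Im (- z) = - Im z.
Proof. by case: z. Qed.
Lemma ReM (R : realType) (z w : R[i]) : Re (z * w) = Re z * Re w - Im z * Im w.
Proof. by case: z; case: w. Qed.
Lemma ImM (R : realType) (z w : R[i]) : Im (z * w) = Re z * Im w + Im z * Re w.
Proof. by case: z => ? ?; case: w. Qed.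

Definition ReImE := (ReD, ImD, ReN, ImN, ReM, ImM).

Lemma complex_ext (R : realType) (z w : R[i]) : Re z = Re w -> Im z = Im w -> z = w.
Proof. by case: z => ? ?; case: w => ? ? /= -> ->. Qed.

Lemma complex_divr (R : realType) (z : R[i]) (r : R) :
  Re (z / r%:C) = Re z / r /\ Im (z / r%:C) = Im z / r.
Proof.
rewrite -(fmorphV (real_complex R)) ReM ImM /=.
by split; rewrite !mulr0 ?subr0 ?add0r.
Qed.

Lemma ler_Re_cabs (R : realType) (z : R[i]) : `|Re z| <= cabs z.
Proof.
case: z => x y /=; rewrite -sqrtr_sqr ler_sqrt ?addr_ge0 ?sqr_ge0//.
by rewrite lerDl sqr_ge0.
Qed.

Lemma ler_Im_cabs (R : realType) (z : R[i]) : `|Im z| <= cabs z.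
Proof.
case: z => x y /=; rewrite -sqrtr_sqr ler_sqrt ?addr_ge0 ?sqr_ge0//.
by rewrite lerDr sqr_ge0.
Qed.

Lemma ler_cabs (R : realType) (z : R[i]) : cabs z <= `|Re z| + `|Im z|.
Proof.
case: z => x y /=; rewrite -(ger0_norm (_ : 0 <= `|x| + `|y|)) ?addr_ge0//.
rewrite -sqrtr_sqr ler_sqrt ?sqr_ge0// sqrrD !real_normK ?num_real//.
by rewrite lerD2r lerDl mulrn_wge0// mulr_ge0.
Qed.

(** * Reduction of complex absolute continuity and derivatives to real ones *)

Definition real_ac (R : realType) (a b : R) (f : R -> R) : Prop :=
  forall e : R, 0 < e -> exists2 d : R, 0 < d &
    forall (m : nat) (p q : 'I_m -> R),
      (forall k, [/\ a <= p k, p k <= q k & q k <= b]) ->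
      (forall k k', k != k' -> q k <= p k' \/ q k' <= p k) ->
      \sum_(k < m) (q k - p k) < d ->
      \sum_(k < m) `|f (q k) - f (p k)| < e.

Lemma abs_contP (R : realType) (a b : R) (f : R -> R[i]) :
  absolutely_continuous a b f <->
  real_ac a b (fun x => Re (f x)) /\ real_ac a b (fun x => Im (f x)).
Proof.
split=> [acf|[acr aci] e e0].
  split=> e /acf[d d0 dP]; exists d => // m p q pq dis /(dP _ _ _ pq dis);
    apply: le_lt_trans; apply: ler_sum => k _; rewrite -?ReN -?ImN -?ReD -?ImD.
    exact: ler_Re_cabs.
  exact: ler_Im_cabs.
have e20 : 0 < e / 2 by lra.
have [d1 d10 d1P] := acr _ e20; have [d2 d20 d2P] := aci _ e20.
exists (Num.min d1 d2); first by rewrite lt_min d10.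
move=> m p q pq dis; rewrite lt_min => /andP[/(d1P _ _ _ pq dis) s1 /(d2P _ _ _ pq dis) s2].
have -> : e = e / 2 + e / 2 by field.
apply: le_lt_trans (ltrD s1 s2); rewrite -big_split /=; apply: ler_sum => k _.
by rewrite -!ReN -!ImN -ReD -ImD ler_cabs.
Qed.

Lemma real_acD (R : realType) (a b : R) (f g : R -> R) :
  real_ac a b f -> real_ac a b g -> real_ac a b (fun x => f x + g x).
Proof.
move=> acf acg e e0; have e20 : 0 < e / 2 by lra.
have [d1 d10 d1P] := acf _ e20; have [d2 d20 d2P] := acg _ e20.
exists (Num.min d1 d2); first by rewrite lt_min d10.
move=> m p q pq dis; rewrite lt_min => /andP[/(d1P _ _ _ pq dis) s1 /(d2P _ _ _ pq dis) s2].
have -> : e = e / 2 + e / 2 by field.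
apply: le_lt_trans (ltrD s1 s2); rewrite -big_split /=; apply: ler_sum => k _.
by rewrite opprD addrACA ler_normD.
Qed.

Lemma lipschitz_real_ac (R : realType) (a b L : R) (f : R -> R) :
  (forall x y, a <= x -> x <= y -> y <= b -> `|f y - f x| <= L * (y - x)) ->
  real_ac a b f.
Proof.
move=> fL e e0; have L0 : 0 < `|L| + 1 by have := normr_ge0 L; lra.
exists (e / (`|L| + 1)); first exact: divr_gt0.
move=> m p q pq _ sd; apply: (@le_lt_trans _ _ (\sum_(k < m) (`|L| + 1) * (q k - p k))).
  apply: ler_sum => k _; have [ap pk qb] := pq k.
  apply: (le_trans (fL _ _ ap pk qb)); rewrite ler_wpM2r ?subr_ge0//.
  by have := ler_norm L; lra.
by rewrite -mulr_sumr mulrC -ltr_pdivlMr.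
Qed.

Lemma cst_real_ac (R : realType) (a b c : R) : real_ac a b (fun=> c).
Proof. by apply: (@lipschitz_real_ac _ _ _ 0) => *; rewrite subrr normr0 mul0r. Qed.

Lemma primitive_real_ac (R : realType) (a b : R) (h : R -> R) :
  summable h -> real_ac a b (primitive h).
Proof.
move=> ih e e0; have [d d0 dP] := primitive_abs_cont ih e0; exists d => // m p q pq dis sd.
have pq' k : p k <= q k by have [] := pq k.
apply: le_lt_trans (dP m p q pq' dis sd); apply: ler_sum => k _.
exact: ler_norm_primitiveB.
Qed.

Lemma is_derive_quotient (R : realType) (f : R -> R) (x l : R) (D : set R) :
  is_derive x 1 f l -> (fun y => (f y - f x) / (y - x)) @ within D (x^') --> l.
Proof.
move=> /is_derive1_caratheodory[g [fg cg <-]]; apply: cvg_within_filter.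
have/continuous_withinNx := cg; apply: cvg_trans; apply: near_eq_cvg.
near=> y; rewrite fg mulfK// subr_eq0.
by near: y; exact: nbhs_dnbhs_neq.
Unshelve. all: end_near. Qed.

(** At an interior point the closed edge is a neighbourhood, so the limit taken within it is
    two-sided. *)
Lemma quotient_is_derive (R : realType) (f : R -> R) (a b x l : R) : a < x < b ->
  (fun y => (f y - f x) / (y - x)) @ within [set` `[a, b]] (x^') --> l ->
  is_derive x 1 f l.
Proof.
move=> /andP[ax xb] H; apply/is_derive1_caratheodory.
exists (fun y => if y == x then l else (f y - f x) / (y - x)); split.
- move=> z; case: eqVneq => [->|zx]; first by rewrite !subrr mulr0.
  by rewrite mulfVK// subr_eq0.
- apply/continuous_withinNx; rewrite eqxx.
  move=> A /H; rewrite /nbhs /= /within /= => HA.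
  near=> y.
  have yx : y != x by near: y; exact: nbhs_dnbhs_neq.
  rewrite /= (negbTE yx).
  have : `[a, b]%classic y.
    rewrite /= in_itv /=; apply/andP; split; apply: ltW; near: y; apply: nbhs_dnbhs.
      exact: lt_nbhsr.
    exact: lt_nbhsl.
  by near: y.
- by rewrite eqxx.
Unshelve. all: end_near. Qed.

Lemma quotientE (R : realType) (f : R -> R[i]) (x : R) :
  ((fun y => Re ((f y - f x) / (y - x)%:C)) = fun y => (Re (f y) - Re (f x)) / (y - x)) /\
  ((fun y => Im ((f y - f x) / (y - x)%:C)) = fun y => (Im (f y) - Im (f x)) / (y - x)).
Proof.
split; apply/funext => y; first by rewrite (complex_divr _ _).1 ReD ReN.
by rewrite (complex_divr _ _).2 ImD ImN.
Qed.

Lemma cderive_at_deriv_on (R : realType) (a b : R) (f df : R -> R[i]) :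
  (forall x, cderive_at f x (df x)) -> deriv_on a b f df.
Proof.
move=> fdf x _; have [d1 d2] := fdf x; rewrite (quotientE f x).1 (quotientE f x).2.
by split; exact: is_derive_quotient.
Qed.

Lemma deriv_on_cderive_at (R : realType) (a b x : R) (f df : R -> R[i]) :
  deriv_on a b f df -> a < x < b -> cderive_at f x (df x).
Proof.
move=> fdf xab; have := fdf x; rewrite (quotientE f x).1 (quotientE f x).2.
move=> [|d1 d2]; first by move/andP: xab => [ax xb]; rewrite !ltW.
by split; exact: (quotient_is_derive xab).
Qed.

Lemma summable_patch (R : realType) (a b c : R) (f : R -> R) :
  (@lebesgue_measure R).-integrable `]a, b[ (EFin \o f) ->
  summable (fun t => if a < t < b then f t - c else 0).
Proof.
move=> iF.
have ic : (@lebesgue_measure R).-integrable `]a, b[ (EFin \o cst c).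
  apply: measurable_bounded_integrable => //.
    rewrite [X in (X < _)%E](lebesgue_measure_itv `]a, b[) /=.
    by case: ifP => // _; rewrite -EFinB ltry.
  by exists `|c|; split => // M cM t _ /=; exact: ltW.
have iB : (@lebesgue_measure R).-integrable `]a, b[ (EFin \o (fun t => f t - c)).
  by have := integrableB _ iF ic; apply.
rewrite /summable (_ : EFin \o _ = (EFin \o (fun t => f t - c)) \_ `]a, b[); last first.
  by apply/funext => t /=; rewrite patchE mem_setE /= in_itv /=; case: ifP.
by apply/integrable_restrict => //; rewrite setTI.
Qed.

Lemma primitive_eq0 (R : realType) (h : R -> R) (x : R) :
  (forall t, t <= x -> h t = 0) -> primitive h x = 0.
Proof.
move=> h0; rewrite /primitive (@eq_Rintegral _ _ _ _ _ (cst 0)); last first.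
  by move=> t; rewrite inE /= in_itv /=; exact: h0.
by rewrite Rintegral_cst// mul0r.
Qed.

Lemma ae_derive_primitive (R : realType) (h : R -> R) : summable h ->
  {ae @lebesgue_measure R, forall x : R, is_derive x 1 (primitive h) (h x)}.
Proof.
move=> ih.
have := @FTC1Ny R h (fun y => summableW `]-oo, y] ih) (open_integrable_locally openT ih).
apply: filterS; first exact: (ae_filter_ringOfSetsType lebesgue_measure).
move=> x [dx <-]; rewrite /primitive derive1E; exact: DeriveDef.
Qed.

(** Data are prescribed at the left endpoint, where the Volterra terms vanish;
    [edge_solution_cauchy] moves them to other points. *)
Lemma edge_solution_exists (R : realType) (a b : R) (V : R -> R[i])
    (lambda c d : R[i]) : in_L1 a b V ->
  exists u du, [/\ edge_solution a b V lambda u du, u a = c & du a = d].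
Proof.
move=> [iVr iVi].
pose A t := if a < t < b then Re (V t) - Re lambda else 0.
pose B t := if a < t < b then Im (V t) - Im lambda else 0.
have iA : summable A := summable_patch (Re lambda) iVr.
have iB : summable B := summable_patch (Im lambda) iVi.
have A0 t : ~~ (a < t < b) -> A t = 0 by rewrite /A => /negbTE ->.
have B0 t : ~~ (a < t < b) -> B t = 0 by rewrite /B => /negbTE ->.
have caff (k l : R) : continuous (fun x => k + l * (x - a)).
  move=> x; apply: cvgD; first exact: cvg_cst.
  by apply: cvgMl_tmp; apply: cvgB; [exact: cvg_id|exact: cvg_cst].
(* The affine function with value [c] and slope [d] at [a] is the solution of u'' = 0; the Volterra
   term adds the effect of [V - lambda]. *)
have [p [q [np nq pE qE]]] := volterra_fixpoint iA iB A0 B0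
  (caff (Re c) (Re d)) (caff (Im c) (Im d)).
pose h1 t := A t * p t - B t * q t; pose h2 t := B t * p t + A t * q t.
have ih1 : summable h1.
  by apply: summableB; [exact: summable_nice iA A0 np|exact: summable_nice iB B0 nq].
have ih2 : summable h2.
  by apply: summableD; [exact: summable_nice iB B0 np|exact: summable_nice iA A0 nq].
have nid : nice a b (fun t : R => t) by apply: continuous_nice => t.
have ith1 : summable (fun t => t * h1 t).
  rewrite (_ : (fun t => _) = (fun t => A t * (t * p t) - B t * (t * q t))); last first.
    by apply/funext => t; rewrite /h1; ring.
  apply: summableB; [apply: (summable_nice iA A0)|apply: (summable_nice iB B0)];
  exact: niceM.
have ith2 : summable (fun t => t * h2 t).
  rewrite (_ : (fun t => _) = (fun t => B t * (t * p t) + A t * (t * q t))); last first.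
    by apply/funext => t; rewrite /h2; ring.
  apply: summableD; [apply: (summable_nice iB B0)|apply: (summable_nice iA A0)];
  exact: niceM.
pose u x := p x +i* q x.
pose du x := (Re d + primitive h1 x) +i* (Im d + primitive h2 x).
have daff (k l x : R) (h : R -> R) : summable h -> summable (fun t => t * h t) ->
    is_derive x 1 (fun x => k + l * (x - a) + volterra h x) (l + primitive h x).
  move=> ih ith; apply: is_deriveD; last exact: is_derive_volterra.
  apply: is_derive_eq.
  by rewrite /GRing.scale /=; ring.
have udu x : cderive_at u x (du x).
  split => /=.
    rewrite (_ : (fun y => _) = (fun x => Re c + Re d * (x - a) + volterra h1 x)); last first.
      by apply/funext => y; exact: pE.
    exact: daff.
  rewrite (_ : (fun y => _) = (fun x => Im c + Im d * (x - a) + volterra h2 x)); last first.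
    by apply/funext => y; exact: qE.
  exact: daff.
(* The function u is Lipschitz: its derivative is a constant plus a primitive, which is bounded by a
   total integral. *)
have lip (f df : R -> R) : (forall x : R, is_derive x 1 f (df x)) ->
    (exists M, forall x, `|df x| <= M) -> real_ac a b f.
  move=> fdf [M dfM]; apply: (@lipschitz_real_ac _ _ _ M) => x y _ xy _.
  have cf : {within `[x, y], continuous f}.
    by apply: derivable_within_continuous => z _; have [] := fdf z.
  have [z _ ->] := MVT_segment xy (fun z _ => fdf z) cf.
  by rewrite normrM (ger0_norm (_ : 0 <= y - x)) ?subr_ge0// ler_wpM2r ?subr_ge0.
have bnd (k : R) (h : R -> R) : summable h ->
    exists M, forall x : R, `|k + primitive h x| <= M.
  move=> ih; exists (`|k| + \int[@lebesgue_measure R]_t `|h t|) => x.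
  rewrite (le_trans (ler_normD _ _))// lerD2l (le_trans (ler_norm_primitive _ ih))//.
  by apply: le_primitive_integral => //; exact: summable_norm.
(* The cut-off coefficients vanish for [t <= a], so all integrals up to [a] are zero and the data at
   [a] are those of the affine part. *)
have nab t : t <= a -> ~~ (a < t < b) by move=> ta; apply/negP => /andP[]; lra.
exists u, du; split; last 2 first.
- rewrite /u pE qE volterraE// volterraE// !primitive_eq0 => [|t ta|t ta].
  + by rewrite !subrr !mulr0 !addr0; case: (c).
  + by rewrite (B0 _ (nab _ ta)) (A0 _ (nab _ ta)) !mul0r addr0 mulr0.
  + by rewrite (B0 _ (nab _ ta)) (A0 _ (nab _ ta)) !mul0r subrr mulr0.
- rewrite /du !primitive_eq0 => [|t ta|t ta].
  + by rewrite !addr0; case: (d).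
  + by rewrite /h2 (B0 _ (nab _ ta)) (A0 _ (nab _ ta)) !mul0r addr0.
  + by rewrite /h1 (B0 _ (nab _ ta)) (A0 _ (nab _ ta)) !mul0r subrr.
split.
  split; [| |exact: cderive_at_deriv_on].
    apply/abs_contP; split => /=.
      by apply: lip (bnd (Re d) _ ih1) => x; have [] := udu x.
    by apply: lip (bnd (Im d) _ ih2) => x; have [] := udu x.
  apply/abs_contP; split => /=.
    by apply: real_acD; [exact: cst_real_ac|exact: primitive_real_ac].
  by apply: real_acD; [exact: cst_real_ac|exact: primitive_real_ac].
have := ae_derive_primitive ih2; have := ae_derive_primitive ih1.
apply: filterS2; first exact: (ae_filter_ringOfSetsType lebesgue_measure).
move=> x d1 d2 xab.
exists (h1 x +i* h2 x).
  split => /=; rewrite -[X in is_derive _ _ _ X]add0r; apply: is_deriveD.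
rewrite /h1 /h2 /A /B xab /u; apply: complex_ext; rewrite !ReImE /=; ring.
Qed.

(** * Vanishing derivative almost everywhere *)

(** Composition with [clamp a b] extends a function from the closed edge to the line by its end
    values, so that facts about functions continuous on the whole line apply. *)
Definition clamp (R : realType) (a b x : R) : R := Num.max a (Num.min x b).

Lemma clamp_in (R : realType) (a b x : R) : a <= b -> a <= clamp a b x <= b.
Proof. by move=> ab; rewrite /clamp le_max lexx ge_max ab ge_min lexx orbT. Qed.

Lemma clamp_id (R : realType) (a b x : R) : a <= x <= b -> clamp a b x = x.
Proof.
by move=> /andP[ax xb]; rewrite /clamp (min_idPl xb) (max_idPr ax).
Qed.

Lemma clamp_mono (R : realType) (a b x y : R) : a <= b -> x <= y ->
  clamp a b x <= clamp a b y <= clamp a b x + (y - x).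
Proof.
move=> ab xy; rewrite /clamp.
by case: (leP x b) => ?; case: (leP y b) => ?; case: (leP a x) => ?;
  case: (leP a y) => ?; case: (leP a b) => ?; lra.
Qed.

Lemma real_ac_unif (R : realType) (a b : R) (f : R -> R) (e : R) :
  real_ac a b f -> 0 < e -> exists2 d, 0 < d & forall x y,
    a <= x -> x <= y -> y <= b -> y - x < d -> `|f y - f x| < e.
Proof.
move=> acf /acf[d d0 dP]; exists d => // x y ax xy yb yxd.
have := dP 1%N (fun=> x) (fun=> y); rewrite !big_ord1; apply => //.
by move=> k k'; rewrite !ord1 eqxx.
Qed.

Lemma real_ac_continuous_clamp (R : realType) (a b : R) (f : R -> R) : a <= b ->
  real_ac a b f -> continuous (fun x => f (clamp a b x)).
Proof.
move=> ab acf x; apply/cvgrPdist_lt => e e0.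
have [d d0 dP] := real_ac_unif acf e0.
near=> y.
have yxd : `|x - y| < d by near: y; exact: cvgr_dist_lt.
have [/andP[ax xb] /andP[ay yb]] := (clamp_in x ab, clamp_in y ab).
move: yxd; case: (leP x y) => xy.
  rewrite ler0_norm ?subr_le0// => yxd; rewrite distrC.
  by have /andP[c1 c2] := clamp_mono ab xy; apply: dP => //; lra.
rewrite gtr0_norm ?subr_gt0// => yxd.
by have /andP[c1 c2] := clamp_mono ab (ltW xy); apply: dP => //; lra.
Unshelve. all: end_near. Qed.

Lemma real_ac_bounded (R : realType) (a b : R) (f : R -> R) : a <= b ->
  real_ac a b f -> exists2 M, 0 <= M & forall x, a <= x <= b -> `|f x| <= M.
Proof.
move=> ab acf.
have [_ [M MP]] := continuous_nice (a - 1) (b + 1) (real_ac_continuous_clamp ab acf).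
exists `|M| => // x /[dup] xab /andP[ax xb]; have := MP x; rewrite clamp_id// => H.
by apply: (le_trans (H _)); [lra|exact: ler_norm].
Qed.

Lemma real_acM (R : realType) (a b : R) (f g : R -> R) : a <= b ->
  real_ac a b f -> real_ac a b g -> real_ac a b (fun x => f x * g x).
Proof.
move=> ab acf acg e e0.
have [M M0 fM] := real_ac_bounded ab acf; have [N N0 gN] := real_ac_bounded ab acg.
have K0 : 0 < M + N + 1 by lra.
(* Each factor is multiplied by at most [M + N + 1], so this tolerance leaves half of [e] to the
   variation of [f] and half to that of [g]; the summand 1 makes the divisor positive. *)
have eK0 : 0 < e / (M + N + 1) / 2 by rewrite !divr_gt0.
have [d1 d10 d1P] := acf _ eK0; have [d2 d20 d2P] := acg _ eK0.
exists (Num.min d1 d2); first by rewrite lt_min d10.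
move=> m p q pq dis; rewrite lt_min => /andP[/(d1P _ _ _ pq dis) s1 /(d2P _ _ _ pq dis) s2].
have -> : e = (M + N + 1) * (e / (M + N + 1) / 2) + (M + N + 1) * (e / (M + N + 1) / 2).
  by field; lra.
apply: (le_lt_trans _ (ltrD (_ : (M + N + 1) * (\sum_(k < m) `|f (q k) - f (p k)|) < _)
  (_ : (M + N + 1) * (\sum_(k < m) `|g (q k) - g (p k)|) < _))); rewrite ?ltr_pM2l//.
rewrite !mulr_sumr -big_split /=; apply: ler_sum => k _.
have [ap pk qb] := pq k.
have -> : f (q k) * g (q k) - f (p k) * g (p k) =
  (f (q k) - f (p k)) * g (q k) + f (p k) * (g (q k) - g (p k)) by ring.
rewrite (le_trans (ler_normD _ _))// !normrM.
have fp : `|f (p k)| <= M by apply: fM; rewrite ap (le_trans pk).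
have gq : `|g (q k)| <= N by apply: gN; rewrite qb (le_trans ap).
by apply: lerD; [rewrite mulrC|]; rewrite ler_wpM2r//; lra.
Qed.

Lemma real_acN (R : realType) (a b : R) (f : R -> R) :
  real_ac a b f -> real_ac a b (fun x => - f x).
Proof.
move=> acf e /acf[d d0 dP]; exists d => // m p q pq dis /(dP _ _ _ pq dis).
by apply: le_lt_trans; apply: ler_sum => k _; rewrite -opprD normrN.
Qed.

Lemma real_ac_sub (R : realType) (a b a' b' : R) (f : R -> R) : a <= a' -> b' <= b ->
  real_ac a b f -> real_ac a' b' f.
Proof.
move=> aa bb acf e /acf[d d0 dP]; exists d => // m p q pq; apply: dP => k.
by have [? ? ?] := pq k; split; lra.
Qed.

(* A sup argument instead of a Vitali covering: [[a, t]] is swept from the left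
   by intervals that either contain a point where the derivative vanishes or lie
   in an open set [U] of small measure; absolute continuity controls the latter. *)
Lemma real_ac_derive0_const (R : realType) (a b : R) (f : R -> R) : a <= b ->
  real_ac a b f ->
  {ae @lebesgue_measure R, forall x, a < x < b -> is_derive x 1 f 0} ->
  f b = f a.
Proof.
move=> ab acf [N [mN N0 NP]].
suff key e : 0 < e -> `|f b - f a| <= e * (b - a) + e.
  apply/eqP; rewrite -subr_eq0 -normr_le0; apply/ler_addgt0Pl => e e0; rewrite addr0.
  have K0 : 0 < b - a + 1 by lra.
  apply: (le_trans (key (e / (b - a + 1)) _)); first exact: divr_gt0.
  by rewrite le_eqVlt; apply/orP; left; apply/eqP; field; lra.
move=> e0; have [d d0 dP] := acf _ e0.
(* With the two endpoints added, every point of [[a, b]] outside [N'] is interior and has derivative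
   0. *)
pose N' := N `|` [set a] `|` [set b].
have mN' : measurable N' by do 2 apply: measurableU => //.
have N'0 : lebesgue_measure N' = 0%E.
  by apply: null_set_setU => //; [exact: measurableU|apply: null_set_setU => //|];
    exact: lebesgue_measure_set1.
have [|U [oU N'U Ud]] := lebesgue_regularity_outer mN' _ d0.
  by rewrite [X in (X < _)%E]N'0 ltry.
have mU : measurable U by exact: open_measurable.
have muU : (lebesgue_measure U < d%:E)%E.
  apply: le_lt_trans Ud.
  apply: (@le_trans _ _ (lebesgue_measure (U `\` N') + lebesgue_measure N')%E); last first.
    by rewrite [X in (_ + X)%E]N'0 adde0.
  have H2 : (lebesgue_measure ((U `\` N') `|` N') <=
      lebesgue_measure (U `\` N') + lebesgue_measure N')%E.
    by apply: measureU2 => //; exact: measurableD.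
  apply: le_trans H2.
  apply: le_measure; rewrite ?inE//; first by apply: measurableU => //; exact: measurableD.
  by move=> x Ux; have [?|?] := pselect (N' x); [right|left].
(* Every point has a radius within which an interval around it either has slope at most [e] or lies
   in [U]. *)
have local x : a <= x <= b -> exists2 r, 0 < r & forall y z,
    a <= y -> y <= x -> x <= z -> z <= b -> x - r < y -> z < x + r ->
    `|f z - f y| <= e * (z - y) \/ `[y, z]%classic `<=` U.
  move=> xab; have [Ux|Ux] := pselect (U x).
    have /nbhs_ballP[r r0 rU] : nbhs x U by exact: open_nbhs_nbhs.
    exists r => // y z _ yx xz _ ry zr; right => t /=; rewrite in_itv /= => /andP[yt tz].
    by apply: rU; rewrite /ball /= ltr_norml; lra.
  have xN' : ~ N' x by move=> /N'U.
  have fx : is_derive x 1 f 0.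
    apply: contrapT => nfx; apply: (xN'); left; left; apply: NP => /= fx; apply/nfx/fx.
    move/andP: xab => [ax xb]; rewrite !lt_neqAle ax xb !andbT.
    by apply/andP; split; apply/negP => /eqP E; apply: (xN'); [left; right|right].
  have /is_derive1_caratheodory[g [fg cg g0]] := fx.
  have : \forall y \near x, `|g x - g y| < e by have/cvgrPdist_lt/(_ e e0) := cg.
  move=> /nbhs_ballP[r r0 rg]; exists r => // y z _ yx xz _ ry zr; left.
  have gy t : y <= t <= z -> `|g t| <= e.
    move=> yt; have := rg t; rewrite g0 sub0r normrN => H; apply/ltW/H.
    by rewrite /ball /= ltr_norml; lra.
  rewrite (_ : f z - f y = (f z - f x) - (f y - f x)); last by ring.
  rewrite !fg (le_trans (ler_normB _ _))// !normrM.
  rewrite (_ : e * (z - y) = e * (z - x) + e * (x - y)); last by ring.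
  rewrite (ger0_norm (_ : 0 <= z - x)) ?subr_ge0//.
  rewrite (ler0_norm (_ : y - x <= 0)) ?subr_le0// opprB.
  by apply: lerD; rewrite ler_wpM2r ?subr_ge0// gy//; lra.
(* The points reachable from [a] when the increment of [f] is paid for by slope [e] plus the
   variation over finitely many ordered intervals inside [U]. *)
pose S := [set t | a <= t <= b /\ exists n (p q : nat -> R), [/\
  forall k, (k < n)%N -> [/\ a <= p k, p k <= q k & q k <= t],
  forall k, (k < n)%N -> `[p k, q k]%classic `<=` U,
  forall k k', (k < k')%N -> (k' < n)%N -> q k <= p k' &
  `|f t - f a| <= e * (t - a) + \sum_(k < n) `|f (q k) - f (p k)|]].
have Sa : S a.
  split; first by rewrite lexx ab.
  exists 0%N, (fun=> 0), (fun=> 0); split => //.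
  by rewrite big_ord0 !subrr normr0 mulr0 addr0.
have Sb x : S x -> x <= b by move=> [/andP[]].
have hS : has_sup S by split; [exists a|exists b => x; exact: Sb].
pose c := sup S.
have ac : a <= c by apply: ub_le_sup => //; case: hS.
have cb : c <= b by apply: ge_sup; [exists a|exact: Sb].
have [|r r0 rP] := local c; first by rewrite ac cb.
have [t St tc] := sup_adherent r0 hS.
have tc' : t <= c by apply: ub_le_sup => //; case: hS.
(* Appending [[t, z]], which contains the supremum [c], puts [z] into [S], hence [z <= c]; this
   excludes [z = c + r / 2] and leaves [z = b]. *)
pose z := Num.min b (c + r / 2).
have zb : z <= b by rewrite ge_min lexx.
have cz : c <= z by rewrite le_min cb; lra.
have zr : z < c + r by rewrite gt_min; apply/orP; right; lra.
have Sz : S z.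
  have [/andP[at_ tb] [n [p [q [pq pU dis ft]]]]] := St.
  split; first by rewrite zb (le_trans ac).
  have fzt : `|f z - f a| <= `|f z - f t| + `|f t - f a|.
    by rewrite (_ : f z - f a = (f z - f t) + (f t - f a)) ?ler_normD//; ring.
  have [fe|tzU] := rP t z at_ tc' cz zb tc zr.
    exists n, p, q; split => //.
      by move=> k /pq[? ? ?]; split => //; lra.
    by lra.
  exists n.+1, (fun k => if k == n then t else p k), (fun k => if k == n then z else q k).
  split.
  - move=> k; rewrite ltnS leq_eqVlt; case: eqVneq => [-> _|_ /= kn].
      by split => //; lra.
    by have [? ? ?] := pq _ kn; split => //; lra.
  - move=> k; rewrite ltnS leq_eqVlt; case: eqVneq => [-> _|_ /= kn] //; exact: pU.
  - move=> k k' kk'; rewrite ltnS => k'n.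
    rewrite (ltn_eqF (leq_trans kk' k'n)).
    case: eqVneq => [k'E|k'N]; first by have [] := pq k (leq_trans kk' k'n).
    by apply: dis => //; rewrite ltn_neqAle k'N.
  - rewrite big_ord_recr /= eqxx.
    under eq_bigr do rewrite (ltn_eqF (ltn_ord _)).
    have : 0 <= e * (z - t) by rewrite mulr_ge0//; lra.
    by lra.
have zc : z <= c by apply: ub_le_sup => //; case: hS.
have zbE : z = b.
  by move: zc; rewrite /z; case: (leP b (c + r / 2)) => // _; lra.
move: Sz; rewrite zbE => -[_ [n [p [q [pq pU dis fb]]]]].
(* The intervals collected up to [b] do not overlap and lie in [U], so their total length is below
   [d] and the variation of [f] over them below [e]. *)
apply: (le_trans fb); rewrite lerD2l; apply: ltW.
have pq' (k : 'I_n) : p k <= q k by have [] := pq k (ltn_ord k).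
have dis' (k k' : 'I_n) : k != k' -> q k <= p k' \/ q k' <= p k.
  move=> kk'; case: (ltngtP k k') => [lt|lt|/val_inj E].
  - by left; exact: dis.
  - by right; exact: dis.
  - by rewrite E eqxx in kk'.
apply: (dP n (fun k => p k) (fun k => q k)) => //.
  by move=> k; exact: pq.
rewrite -lte_fin -(lebesgue_measure_bigsetU_itv pq' dis').
apply: le_lt_trans muU; apply: le_measure; rewrite ?inE//.
  exact: bigsetU_measurable.
elim/big_ind : _ => [x []|A B AU BU x [/AU|/BU]//|k _ x pqx].
by apply: (pU k (ltn_ord k)); exact: subset_itv_oc_cc.
Qed.

(** * Wronskians and uniqueness *)

Lemma cderive_atM (R : realType) (f g : R -> R[i]) (x : R) (d e : R[i]) :
  cderive_at f x d -> cderive_at g x e ->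
  cderive_at (fun y => f y * g y) x (d * g x + f x * e).
Proof.
move=> [f1 f2] [g1 g2]; split.
  rewrite (_ : (fun y => _) = (fun y => Re (f y)) * (fun y => Re (g y)) -
    (fun y => Im (f y)) * (fun y => Im (g y))); last by apply/funext => y; rewrite ReM.
  apply: is_derive_eq; rewrite !ReImE /GRing.scale /=; ring.
rewrite (_ : (fun y => _) = (fun y => Re (f y)) * (fun y => Im (g y)) +
  (fun y => Im (f y)) * (fun y => Re (g y))); last by apply/funext => y; rewrite ImM.
apply: is_derive_eq; rewrite !ReImE /GRing.scale /=; ring.
Qed.

Lemma cderive_atD (R : realType) (f g : R -> R[i]) (x : R) (d e : R[i]) :
  cderive_at f x d -> cderive_at g x e ->
  cderive_at (fun y => f y + g y) x (d + e).
Proof.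
move=> [f1 f2] [g1 g2]; split.
  rewrite (_ : (fun y => _) = (fun y => Re (f y)) + (fun y => Re (g y))); last first.
    by apply/funext => y; rewrite ReD.
  by apply: is_derive_eq; rewrite ReD.
rewrite (_ : (fun y => _) = (fun y => Im (f y)) + (fun y => Im (g y))); last first.
  by apply/funext => y; rewrite ImD.
by apply: is_derive_eq; rewrite ImD.
Qed.

Lemma cderive_at_cst (R : realType) (c : R[i]) (x : R) : cderive_at (fun=> c) x 0.
Proof. by split; exact: is_derive_cst. Qed.

Lemma cderive_atZ (R : realType) (c : R[i]) (f : R -> R[i]) (x : R) (d : R[i]) :
  cderive_at f x d -> cderive_at (fun y => c * f y) x (c * d).
Proof. by move=> fd; have := cderive_atM (cderive_at_cst c x) fd; rewrite mul0r add0r. Qed.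

Lemma abs_contD (R : realType) (a b : R) (f g : R -> R[i]) :
  absolutely_continuous a b f -> absolutely_continuous a b g ->
  absolutely_continuous a b (fun x => f x + g x).
Proof.
move=> /abs_contP[f1 f2] /abs_contP[g1 g2]; apply/abs_contP; split.
  by under eq_fun do rewrite ReD; exact: (real_acD f1 g1).
by under eq_fun do rewrite ImD; exact: (real_acD f2 g2).
Qed.

Lemma abs_contM (R : realType) (a b : R) (f g : R -> R[i]) : a <= b ->
  absolutely_continuous a b f -> absolutely_continuous a b g ->
  absolutely_continuous a b (fun x => f x * g x).
Proof.
move=> ab /abs_contP[f1 f2] /abs_contP[g1 g2]; apply/abs_contP; split.
  under eq_fun do rewrite ReM.
  exact: (real_acD (real_acM ab f1 g1) (real_acN (real_acM ab f2 g2))).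
under eq_fun do rewrite ImM.
exact: (real_acD (real_acM ab f1 g2) (real_acM ab f2 g1)).
Qed.

Lemma abs_cont_cst (R : realType) (a b : R) (c : R[i]) :
  absolutely_continuous a b (fun=> c).
Proof. by apply/abs_contP; split; exact: cst_real_ac. Qed.

Lemma abs_contZ (R : realType) (a b : R) (c : R[i]) (f : R -> R[i]) : a <= b ->
  absolutely_continuous a b f -> absolutely_continuous a b (fun x => c * f x).
Proof. by move=> ab acf; apply: abs_contM => //; exact: abs_cont_cst. Qed.

Lemma deriv_onD (R : realType) (a b : R) (f g df dg : R -> R[i]) :
  deriv_on a b f df -> deriv_on a b g dg ->
  deriv_on a b (fun x => f x + g x) (fun x => df x + dg x).
Proof.
move=> fd gd x xab; have [f1 f2] := fd x xab; have [g1 g2] := gd x xab.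
have E y : (f y + g y - (f x + g x)) / (y - x)%:C =
  (f y - f x) / (y - x)%:C + (g y - g x) / (y - x)%:C by rewrite -mulrDl; congr (_ * _); ring.
by split; under eq_fun do rewrite E ?ReD ?ImD; rewrite ?ReD ?ImD; exact: cvgD.
Qed.

Lemma deriv_onZ (R : realType) (a b : R) (c : R[i]) (f df : R -> R[i]) :
  deriv_on a b f df -> deriv_on a b (fun x => c * f x) (fun x => c * df x).
Proof.
move=> fd x xab; have [f1 f2] := fd x xab.
have E y : (c * f y - c * f x) / (y - x)%:C = c * ((f y - f x) / (y - x)%:C).
  by rewrite -mulrBr mulrA.
split; under eq_fun do rewrite E.
  under eq_fun do rewrite ReM; rewrite ReM.
  exact: (cvgB (cvgM (cvg_cst _) f1) (cvgM (cvg_cst _) f2)).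
under eq_fun do rewrite ImM; rewrite ImM.
exact: (cvgD (cvgM (cvg_cst _) f2) (cvgM (cvg_cst _) f1)).
Qed.

Lemma edge_solutionD (R : realType) (a b : R) (V : R -> R[i]) (lambda : R[i])
    (u du v dv : R -> R[i]) :
  edge_solution a b V lambda u du -> edge_solution a b V lambda v dv ->
  edge_solution a b V lambda (fun x => u x + v x) (fun x => du x + dv x).
Proof.
move=> [[u1 u2 u3] u4] [[v1 v2 v3] v4]; split.
  by split; [exact: abs_contD|exact: abs_contD|exact: deriv_onD].
apply: (filterS2 _ _ u4 v4); first exact: (ae_filter_ringOfSetsType lebesgue_measure).
move=> x /= ux vx xab; have [d1 ud e1] := ux xab; have [d2 vd e2] := vx xab.
exists (d1 + d2); first exact: cderive_atD.
by rewrite !mulrDr -e1 -e2; ring.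
Qed.

Lemma edge_solutionZ (R : realType) (a b : R) (V : R -> R[i]) (lambda c : R[i])
    (u du : R -> R[i]) : a <= b -> edge_solution a b V lambda u du ->
  edge_solution a b V lambda (fun x => c * u x) (fun x => c * du x).
Proof.
move=> ab [[u1 u2 u3] u4]; split.
  by split; [exact: abs_contZ|exact: abs_contZ|exact: deriv_onZ].
apply: filterS u4; first exact: (ae_filter_ringOfSetsType lebesgue_measure).
move=> x /= ux xab; have [d ud e] := ux xab.
exists (c * d); first exact: cderive_atZ.
by rewrite [lambda * _]mulrCA -e; ring.
Qed.

Lemma edge_solution0 (R : realType) (a b : R) (V : R -> R[i]) (lambda : R[i]) :
  edge_solution a b V lambda (fun=> 0) (fun=> 0).
Proof.
split.
  split; [exact: abs_cont_cst|exact: abs_cont_cst|].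
  by apply: cderive_at_deriv_on => x; exact: cderive_at_cst.
apply: aeW => x _; exists 0; first exact: cderive_at_cst.
by rewrite !mulr0 oppr0 addr0.
Qed.

Lemma edge_solution_sum (R : realType) (a b : R) (V : R -> R[i]) (lambda : R[i])
    (m : nat) (c : 'I_m -> R[i]) (y : 'I_m -> (R -> R[i]) * (R -> R[i])) : a <= b ->
  (forall k, edge_solution a b V lambda (y k).1 (y k).2) ->
  edge_solution a b V lambda (fun x => \sum_(k < m) c k * (y k).1 x)
    (fun x => \sum_(k < m) c k * (y k).2 x).
Proof.
move=> ab; elim: m c y => [|m IH] c y sol.
  under eq_fun do rewrite big_ord0.
  under [X in edge_solution _ _ _ _ _ X]eq_fun do rewrite big_ord0.
  exact: edge_solution0.
under eq_fun do rewrite big_ord_recl.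
under [X in edge_solution _ _ _ _ _ X]eq_fun do rewrite big_ord_recl.
apply: edge_solutionD; first exact: edge_solutionZ.
by apply: (IH (fun k => c (lift ord0 k)) (fun k => y (lift ord0 k))).
Qed.

Lemma edge_solution_sub (R : realType) (a b a' b' : R) (V : R -> R[i])
    (lambda : R[i]) (u du : R -> R[i]) : a <= a' -> b' <= b ->
  edge_solution a b V lambda u du -> edge_solution a' b' V lambda u du.
Proof.
move=> aa bb [[/abs_contP[u1 u2] /abs_contP[v1 v2] u3] u4]; split.
  split; [by apply/abs_contP; split; exact: real_ac_sub aa bb _|
          by apply/abs_contP; split; exact: real_ac_sub aa bb _|].
  move=> x /andP[ax xb].
  have [|d1 d2] := u3 x; first by apply/andP; split; lra.
  have sub : within [set` `[a', b']] (x^') --> within [set` `[a, b]] (x^').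
    apply: within_subset => t /=; rewrite !in_itv /=; lra.
  by split; [apply: cvg_trans d1|apply: cvg_trans d2]; exact: cvg_app sub.
apply: filterS u4; first exact: (ae_filter_ringOfSetsType lebesgue_measure).
by move=> x ux /andP[ax xb]; apply: ux; apply/andP; split; lra.
Qed.

Definition wronskian (R : realType) (u du v dv : R -> R[i]) (x : R) : R[i] :=
  u x * dv x - du x * v x.

(** The derivative is u v'' - u'' v, which vanishes almost everywhere because u'' and v'' are the
    same multiple [V - lambda] of u and v. *)
Lemma wronskian_const (R : realType) (a b : R) (V : R -> R[i]) (lambda : R[i])
    (u du v dv : R -> R[i]) (x : R) :
  edge_solution a b V lambda u du -> edge_solution a b V lambda v dv ->
  a <= x <= b -> wronskian u du v dv x = wronskian u du v dv a.
Proof.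
move=> us vs /andP[ax xb].
(* [real_ac_derive0_const] compares the two ends of an interval, hence the restriction to
   [[a, x]]. *)
have [[u1 u2 u3] u4] := edge_solution_sub (lexx a) xb us.
have [[v1 v2 v3] v4] := edge_solution_sub (lexx a) xb vs.
pose W y := u y * dv y + (-1) * (du y * v y).
have -> : wronskian u du v dv = W by apply/funext => y; rewrite /W mulN1r.
have acW : absolutely_continuous a x W.
  by apply: abs_contD; [exact: abs_contM|apply: abs_contZ => //; exact: abs_contM].
have W0 : {ae @lebesgue_measure R, forall y, a < y < x -> cderive_at W y 0}.
  apply: (filterS2 _ _ u4 v4); first exact: (ae_filter_ringOfSetsType lebesgue_measure).
  move=> y /= uy vy yax; have [d1 ud e1] := uy yax; have [d2 vd e2] := vy yax.
  have D1 := cderive_atM (deriv_on_cderive_at u3 yax) vd.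
  have D2 := cderive_atZ (-1) (cderive_atM ud (deriv_on_cderive_at v3 yax)).
  have := cderive_atD D1 D2; congr (cderive_at _ _ _).
  have -> : d1 = V y * u y - lambda * u y by rewrite -e1; ring.
  have -> : d2 = V y * v y - lambda * v y by rewrite -e2; ring.
  by ring.
have [W1 W2] := (abs_contP _ _ _).1 acW.
apply: complex_ext.
  apply: (real_ac_derive0_const ax W1); apply: filterS W0.
    exact: (ae_filter_ringOfSetsType lebesgue_measure).
  by move=> y H /H [].
apply: (real_ac_derive0_const ax W2); apply: filterS W0.
  exact: (ae_filter_ringOfSetsType lebesgue_measure).
by move=> y H /H [].
Qed.

(** The data at [a] are (1, 0) and (0, 1). Since the Wronskian is 1, solutions with data at any
    point can be written down, and a solution is recovered from its Wronskians with the two. *)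
Lemma fundamental_system (R : realType) (a b : R) (V : R -> R[i]) (lambda : R[i]) :
  in_L1 a b V -> exists u du v dv, [/\ edge_solution a b V lambda u du,
    edge_solution a b V lambda v dv &
    forall x, a <= x <= b -> u x * dv x - du x * v x = 1].
Proof.
move=> VL1.
have [u [du [us ua dua]]] := edge_solution_exists lambda 1 0 VL1.
have [v [dv [vs va dva]]] := edge_solution_exists lambda 0 1 VL1.
exists u, du, v, dv; split => // x xab.
have := wronskian_const us vs xab; rewrite /wronskian => ->.
by rewrite ua dua va dva mul0r subr0 mulr1.
Qed.

Lemma edge_solution_cauchy (R : realType) (a b : R) (V : R -> R[i])
    (lambda : R[i]) (x0 : R) (c d : R[i]) : in_L1 a b V -> a <= x0 <= b ->
  exists u du, [/\ edge_solution a b V lambda u du, u x0 = c & du x0 = d].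
Proof.
move=> VL1 x0ab; have ab : a <= b by lra.
have [u [du [v [dv [us vs uv]]]]] := fundamental_system lambda VL1.
(* Cramer's rule for the data at [x0]; the determinant is the Wronskian, equal to 1. *)
pose k := c * dv x0 - d * v x0; pose l := u x0 * d - du x0 * c.
exists (fun x => k * u x + l * v x), (fun x => k * du x + l * dv x); split.
- by apply: edge_solutionD; exact: edge_solutionZ.
- by rewrite -[RHS]mulr1 -(uv x0 x0ab) /k /l; ring.
- by rewrite -[RHS]mulr1 -(uv x0 x0ab) /k /l; ring.
Qed.

(* If the Cauchy data vanish at one point, the Wronskian with every solution
   vanishes identically. *)
Lemma edge_solution_eq0 (R : realType) (a b : R) (V : R -> R[i]) (lambda : R[i])
    (x0 : R) (u du : R -> R[i]) : in_L1 a b V -> a <= x0 <= b ->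
  edge_solution a b V lambda u du -> u x0 = 0 -> du x0 = 0 ->
  forall x, a <= x <= b -> u x = 0 /\ du x = 0.
Proof.
move=> VL1 x0ab us ux0 dux0 x xab.
have [v [dv [w [dw [vs ws vw]]]]] := fundamental_system lambda VL1.
have W0 z dz : edge_solution a b V lambda z dz -> u x * dz x - du x * z x = 0.
  move=> zs; have := wronskian_const us zs xab; rewrite /wronskian => ->.
  have := wronskian_const us zs x0ab; rewrite /wronskian => <-.
  by rewrite ux0 dux0 !mul0r subrr.
have Wv := W0 _ _ vs; have Ww := W0 _ _ ws; have vwx := vw x xab.
split.
  have -> : u x = (u x * dw x - du x * w x) * v x - (u x * dv x - du x * v x) * w x.
    by rewrite -[LHS]mulr1 -vwx; ring.
  by rewrite Wv Ww !mul0r subrr.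
have -> : du x = (u x * dw x - du x * w x) * dv x - (u x * dv x - du x * v x) * dw x.
  by rewrite -[LHS]mulr1 -vwx; ring.
by rewrite Wv Ww !mul0r subrr.
Qed.

Lemma edge_solution_unique (R : realType) (a b : R) (V : R -> R[i]) (lambda : R[i])
    (x0 : R) (u du v dv : R -> R[i]) : in_L1 a b V -> a <= x0 <= b ->
  edge_solution a b V lambda u du -> edge_solution a b V lambda v dv ->
  u x0 = v x0 -> du x0 = dv x0 ->
  forall x, a <= x <= b -> u x = v x /\ du x = dv x.
Proof.
move=> VL1 x0ab us vs e1 e2 x xab; have ab : a <= b by lra.
have [||w0 dw0] := edge_solution_eq0 VL1 x0ab
  (edge_solutionD us (edge_solutionZ (-1) ab vs)) _ _ xab.
- by rewrite e1 mulN1r subrr.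
- by rewrite e2 mulN1r subrr.
by split; apply/eqP; rewrite -subr_eq0 -mulN1r; apply/eqP.
Qed.

Lemma cauchy_solutionP (R : realType) (a b : R) (V : R -> R[i])
    (lambda : R[i]) (x0 : R) (c d : R[i]) (p := cauchy_solution a b V lambda x0 c d) :
  in_L1 a b V -> a <= x0 <= b ->
  [/\ edge_solution a b V lambda p.1 p.2, p.1 x0 = c & p.2 x0 = d].
Proof.
move=> VL1 x0ab; rewrite /p /cauchy_solution; case: xgetP => // none.
have [u [du sol]] := edge_solution_cauchy lambda c d VL1 x0ab.
by have := none (u, du).
Qed.

(** * Continuous representatives of square-integrable classes *)

Lemma abs_cont_in_L2 (R : realType) (a b : R) (w : R -> R[i]) : a <= b ->
  absolutely_continuous a b w -> in_L2 a b w.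
Proof.
move=> ab /abs_contP[w1 w2].
have meas (f : R -> R) : real_ac a b f -> measurable_fun `]a, b[ f.
  move=> acf; apply: (eq_measurable_fun (fun x => f (clamp a b x))).
    move=> x; rewrite inE /= in_itv /= => /andP[ax xb].
    by rewrite clamp_id// !ltW.
  apply: measurable_funTS; apply: continuous_measurable_fun.
  exact: real_ac_continuous_clamp.
have m1 := meas _ w1; have m2 := meas _ w2; split => //.
have [M M0 wM] := real_ac_bounded ab w1; have [N N0 wN] := real_ac_bounded ab w2.
have cE x : cabs (w x) ^+ 2 = Re (w x) ^+ 2 + Im (w x) ^+ 2.
  by case: (w x) => p q /=; rewrite sqr_sqrtr// addr_ge0// sqr_ge0.
have m : measurable_fun `]a, b[ (fun x => cabs (w x) ^+ 2).
  rewrite (_ : (fun x => _) = fun x => Re (w x) ^+ 2 + Im (w x) ^+ 2); last first.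
    by apply/funext => x; exact: cE.
  by apply: measurable_funD; apply: measurable_funX.
have : (@lebesgue_measure R).-integrable `]a, b[ (EFin \o (fun x => cabs (w x) ^+ 2)).
  apply: measurable_bounded_integrable => //.
    rewrite [X in (X < _)%E](lebesgue_measure_itv `]a, b[) /=.
    by case: ifP => // _; rewrite -EFinB ltry.
  exists (M ^+ 2 + N ^+ 2); split => [|K MK x]; first exact: num_real.
  rewrite /= in_itv /= => /andP[ax xb].
  rewrite (le_trans _ (ltW MK))// cE ger0_norm ?addr_ge0 ?sqr_ge0//.
  have xab : a <= x <= b by rewrite !ltW.
  rewrite -(real_normK (num_real (Re (w x)))) -(real_normK (num_real (Im (w x)))).
  by apply: lerD; rewrite lerXn2r ?nnegrE ?wM ?wN.
move=> /integrableP[_]; apply: le_lt_trans.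
apply: ge0_le_integral => //.
- by move=> x _; rewrite lee_fin sqr_ge0.
- exact/measurable_EFinP.
- by apply/measurable_EFinP; exact: measurableT_comp.
by move=> x _; rewrite lee_fin ler_norm.
Qed.

(** A nonzero value persists on a ball, which meets the open edge in an interval of positive length,
    even around an endpoint. *)
Lemma continuous_ae0 (R : realType) (a b : R) (f : R -> R) : a < b -> continuous f ->
  {ae @lebesgue_measure R, forall x, a < x < b -> f x = 0} ->
  forall x, a <= x <= b -> f x = 0.
Proof.
move=> ab cf [N [mN N0 NP]] x /andP[ax xb]; apply/eqP; apply: contraT => fx0.
have : \forall y \near x, f y != 0.
  have /cvgrPdist_lt/(_ `|f x|) := cf x; rewrite normr_gt0 => /(_ fx0).
  by apply: filterS => y H; apply/eqP => fy; move: H; rewrite fy subr0 ltxx.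
move=> /nbhs_ballP[r /= r0 rP].
pose c := Num.max a (x - r); pose d := Num.min b (x + r).
have cd : c < d by rewrite /c /d gt_max !lt_min ab /=; apply/and3P; split; lra.
have sub : `]c, d[%classic `<=` N.
  move=> y; rewrite /= in_itv /= /c /d gt_max lt_min => /andP[/andP[y1 y2] /andP[y3 y4]].
  apply: NP => /= /(_ _) H; have : f y != 0 by apply: rP; rewrite /ball /= ltr_norml; lra.
  by rewrite H ?eqxx// y1 y3.
have : (lebesgue_measure `]c, d[%classic <= lebesgue_measure N)%E.
  by apply: le_measure; rewrite ?inE.
rewrite [X in (_ <= X)%E]N0 [X in (X <= _)%E](lebesgue_measure_itv `]c, d[) /= lte_fin cd.
by rewrite -EFinB lee_fin; lra.
Qed.

(** Injectivity in [in_resolvent_set] only gives vanishing almost everywhere, whereas the Cauchy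
    data at the origin are needed. Inside the edge the derivative vanishes with the function; at the
    ends it does so by continuity. *)
Lemma regular_ae0 (R : realType) (a b : R) (u du : R -> R[i]) : a < b ->
  regular a b u du -> {ae @lebesgue_measure R, forall x, a < x < b -> u x = 0} ->
  forall x, a <= x <= b -> u x = 0 /\ du x = 0.
Proof.
move=> ab [/abs_contP[u1 u2] /abs_contP[v1 v2] uD] u0.
have ab' := ltW ab.
have key (f : R -> R) : real_ac a b f ->
    {ae @lebesgue_measure R, forall x, a < x < b -> f x = 0} ->
    forall x, a <= x <= b -> f x = 0.
  move=> acf f0 x xab.
  rewrite -(clamp_id xab).
  apply: (continuous_ae0 ab (real_ac_continuous_clamp ab' acf)) => //.
  apply: filterS f0; first exact: (ae_filter_ringOfSetsType lebesgue_measure).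
  by move=> y fy /[dup] yab /fy; rewrite clamp_id//; move/andP: yab => [? ?]; rewrite !ltW.
have u00 x : a <= x <= b -> u x = 0.
  move=> xab; apply: complex_ext.
    apply: (key _ u1) => //; apply: filterS u0.
      exact: (ae_filter_ringOfSetsType lebesgue_measure).
    by move=> y H /H ->.
  apply: (key _ u2) => //; apply: filterS u0.
    exact: (ae_filter_ringOfSetsType lebesgue_measure).
  by move=> y H /H ->.
have der0 (f : R -> R) (x l : R) : (forall y, a <= y <= b -> f y = 0) -> a < x < b ->
    is_derive x 1 f l -> l = 0.
  move=> f0 xab fl.
  have E : f x = 0 by apply: f0; move/andP: xab => [? ?]; rewrite !ltW.
  have /is_derive1_caratheodory[g [fg cg <-]] := fl.
  have/continuous_withinNx := cg => cg'.
  have : g @ x^' --> (0 : R).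
    apply: cvg_near_cst; near=> y.
    have yx : y - x != 0 by rewrite subr_eq0; near: y; exact: nbhs_dnbhs_neq.
    apply: (mulIf yx); rewrite mul0r -fg E subr0; apply: f0.
    apply/andP; split; apply: ltW; near: y; apply: nbhs_dnbhs.
      by apply: lt_nbhsr; case/andP: xab.
    by apply: lt_nbhsl; case/andP: xab.
  by move=> /(cvg_unique _ cg') ->.
have du0 x : a < x < b -> du x = 0.
  move=> xab; have [d1 d2] := deriv_on_cderive_at uD xab.
  apply: complex_ext.
    by apply: der0 xab d1 => y /u00 ->.
  by apply: der0 xab d2 => y /u00 ->.
move=> x xab; split; first exact: u00.
apply: complex_ext.
  by apply: (key _ v1) => //; apply: aeW => y /du0 ->.
by apply: (key _ v2) => //; apply: aeW => y /du0 ->.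
Unshelve. all: end_near. Qed.

(** * Linear algebra of the boundary conditions *)

(* Adding [t] times the upper block row makes the lower right block invertible. *)
Lemma det_block_diag (F : fieldType) (n : nat) (Y Y' : 'M[F]_n) (z w : 'rV[F]_n) :
  \det (block_mx Y (diag_mx z) Y' (diag_mx w)) =
  \det (diag_mx w *m Y - diag_mx z *m Y').
Proof.
have [/existsP[k /andP[/eqP zk /eqP wk]]|/existsPn zw] :=
    boolP [exists k, (z 0 k == 0) && (w 0 k == 0)].
  (* If [z] and [w] both vanish at [k], the left matrix has a zero column and the right one a zero
     row. *)
  rewrite (expand_det_col _ (rshift n k)) big1 => [|i _]; last first.
    case: (split_ordP i) => i' ->.
      rewrite block_mxEur mxE; case: eqVneq => [->|_]; first by rewrite zk mulr1n mul0r.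
      by rewrite mulr0n mul0r.
    rewrite block_mxEdr mxE; case: eqVneq => [->|_]; first by rewrite wk mulr1n mul0r.
    by rewrite mulr0n mul0r.
  rewrite (expand_det_row _ k) big1// => i _.
  by rewrite !mul_diag_mx !mxE zk wk !mul0r subrr mul0r.
(* Thus [d] is [w] where that is nonzero and [z] elsewhere, hence invertible. *)
pose t : 'rV[F]_n := \row_k (w 0 k == 0)%:R.
pose d : 'rV[F]_n := \row_k (t 0 k * z 0 k + w 0 k).
pose e : 'rV[F]_n := \row_k (d 0 k)^-1.
have d0 k : d 0 k != 0.
  rewrite !mxE; case: (eqVneq (w 0 k) 0) => wk; last by rewrite mul0r add0r.
  by rewrite mul1r wk addr0; have := zw k; rewrite wk eqxx andbT.
pose P := diag_mx t *m Y + Y'.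
have -> : \det (block_mx Y (diag_mx z) Y' (diag_mx w)) =
    \det (block_mx Y (diag_mx z) P (diag_mx d)).
  have -> : block_mx Y (diag_mx z) P (diag_mx d) =
      block_mx 1%:M 0 (diag_mx t) 1%:M *m block_mx Y (diag_mx z) Y' (diag_mx w).
    rewrite mulmx_block !mul1mx !mul0mx !addr0; congr block_mx.
    by apply/matrixP => i j; rewrite mul_diag_mx !mxE; case: (eqVneq i j) => [->|_];
      rewrite ?mulr1n ?mulr0n ?mulr0 ?addr0.
  by rewrite det_mulmx det_lblock !det1 !mul1r.
have eP : diag_mx d *m (diag_mx e *m P) = P.
  apply/matrixP => i j; have := d0 i; rewrite !mul_diag_mx !mxE => di.
  by rewrite mulrA mulfV// mul1r.
(* A Schur complement: column operations clear [P] with the invertible block [diag_mx d]. *)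
have -> : \det (block_mx Y (diag_mx z) P (diag_mx d)) =
    \det (Y - diag_mx z *m (diag_mx e *m P)) * \det (diag_mx d).
  rewrite -(@det_ublock F n n (Y - diag_mx z *m (diag_mx e *m P)) (diag_mx z)).
  have -> : block_mx (Y - diag_mx z *m (diag_mx e *m P)) (diag_mx z) 0 (diag_mx d) =
      block_mx Y (diag_mx z) P (diag_mx d) *m block_mx 1%:M 0 (- (diag_mx e *m P)) 1%:M.
    by rewrite mulmx_block !mulmx1 !mulmx0 !add0r !mulmxN eP subrr.
  by rewrite det_mulmx det_lblock !det1 !mulr1.
(* Row by row, (t z + w) Y - z (t Y + Y') = w Y - z Y', so [t] disappears. *)
rewrite mulrC -det_mulmx; congr (\det _); apply/matrixP => i j.
rewrite /P !mul_diag_mx !mxE; have := d0 i; rewrite !mxE; set c := (_ == _)%:R => ci.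
by field.
Qed.

Section conjugate_transpose.
Variable R : realType.
Local Notation C := R[i].

Lemma adjmxE m n (A : 'M[C]_(m, n)) i j : adjmx A i j = conjc (A j i).
Proof. by rewrite !mxE. Qed.

Lemma adjmxK m n (A : 'M[C]_(m, n)) : adjmx (adjmx A) = A.
Proof. by apply/matrixP => i j; rewrite !adjmxE conjcK. Qed.

Lemma adjmx_mul m n p (A : 'M[C]_(m, n)) (B : 'M[C]_(n, p)) :
  adjmx (A *m B) = adjmx B *m adjmx A.
Proof. by rewrite /adjmx trmx_mul map_mxM. Qed.

Lemma adjmx0 m n : adjmx (0 : 'M[C]_(m, n)) = 0.
Proof. by rewrite /adjmx trmx0 map_mx0. Qed.

(** The conjugate transpose of [c] is a left null vector of a matrix with independent rows. *)
Lemma adjmx_row_free_inj n (A1 A2 : 'M[C]_n) (c : 'cV[C]_n) :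
  \rank (row_mx A1 A2) = n -> adjmx A1 *m c = 0 -> adjmx A2 *m c = 0 -> c = 0.
Proof.
move=> rk c1 c2; rewrite -[c]adjmxK.
have -> : adjmx c = 0; last by rewrite adjmx0.
have free : row_free (row_mx A1 A2) by rewrite /row_free rk.
apply: (row_free_inj free); rewrite mul0mx mul_mx_row.
by rewrite -[A1]adjmxK -[A2]adjmxK -!adjmx_mul c1 c2 !adjmx0 row_mx0.
Qed.

(** A dimension count: the kernel of [A1 A2] has dimension n; by self-adjointness it contains all
    pairs (- A2^* c, A1^* c), and by the rank condition these also form a space of dimension n.
    Transposes appear because [kermx] and [submx] deal with row spaces. *)
Lemma self_adjoint_kernel n (A1 A2 : 'M[C]_n) (p q : 'cV[C]_n) :
  \rank (row_mx A1 A2) = n -> A1 *m adjmx A2 = A2 *m adjmx A1 ->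
  A1 *m p + A2 *m q = 0 ->
  exists c : 'cV[C]_n, p = - adjmx A2 *m c /\ q = adjmx A1 *m c.
Proof.
move=> rk sa pq0.
pose N := (row_mx A1 A2)^T.
pose K := row_mx (- adjmx A2)^T (adjmx A1)^T.
have KN : (K <= kermx N)%MS.
  apply/sub_kermxP; rewrite /K /N tr_row_mx mul_row_col -!trmx_mul -linearD /=.
  by rewrite mulmxN sa addNr trmx0.
have freeK : row_free K.
  rewrite -kermx_eq0; apply/eqP/row_matrixP => i; rewrite row0.
  have /sub_kermxP : (row i (kermx K) <= kermx K)%MS by exact: row_sub.
  move: (row i _) => v; rewrite /K mul_mx_row -row_mx0 => /eq_row_mx[v1 v2].
  apply: trmx_inj; rewrite trmx0; apply: (adjmx_row_free_inj rk).
    by apply: trmx_inj; rewrite trmx_mul trmxK trmx0.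
  apply: trmx_inj; rewrite trmx_mul trmxK trmx0; apply: oppr_inj.
  by rewrite oppr0 -mulmxN -linearN.
have NK : (kermx N <= K)%MS.
  have := mxrank_leqif_sup KN; rewrite mxrank_ker /N mxrank_tr rk (eqP freeK) addnK.
  by move=> [_ <-].
have pqN : (row_mx p^T q^T <= kermx N)%MS.
  apply/sub_kermxP; rewrite /N tr_row_mx mul_row_col -!trmx_mul -linearD /=.
  by rewrite pq0 trmx0.
have /submxP[D] := submx_trans pqN NK.
rewrite /K mul_mx_row => /eq_row_mx[pD qD].
exists D^T; split; apply: trmx_inj; rewrite trmx_mul trmxK//.
Qed.

(** As [g * conjc h] is real, the pair (g, h) is proportional to its conjugate. This links the
    conjugated data of [Z] to the condition at the tip. *)
Lemma self_adjoint_pair (g h a b : C) : (g != 0) || (h != 0) ->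
  g * conjc h = h * conjc g ->
  (conjc g * a + conjc h * b == 0) = (g * a + h * b == 0).
Proof.
move=> gh0 sa; have [g0|g0] := eqVneq g 0.
  have h0 : h != 0 by move: gh0; rewrite g0 eqxx.
  rewrite g0 conjc0 !mul0r !add0r !mulf_eq0 conjc_eq0.
  by rewrite (negbTE h0).
have E : g * (conjc g * a + conjc h * b) = conjc g * (g * a + h * b).
  by rewrite mulrDr (mulrA g (conjc h)) sa; ring.
have cg0 : conjc g != 0 by rewrite conjc_eq0.
by rewrite -(mulrI_eq0 _ (mulfI g0)) E (mulrI_eq0 _ (mulfI cg0)).
Qed.

Lemma diag_row_mx_neq0 n (B1 B2 : 'M[C]_n) i : is_diag_mx B1 -> is_diag_mx B2 ->
  \rank (row_mx B1 B2) = n -> (B1 i i != 0) || (B2 i i != 0).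
Proof.
move=> /is_diag_mxP d1 /is_diag_mxP d2 rk; apply: contraT.
rewrite negb_or !negbK => /andP[/eqP b1 /eqP b2].
have free : row_free (row_mx B1 B2) by rewrite /row_free rk.
have : delta_mx 0 i = 0 :> 'rV[C]_n.
  apply: (row_free_inj free); rewrite mul0mx mul_mx_row -!rowE.
  have -> : row i B1 = 0.
    by apply/rowP => k; rewrite !mxE; case: (eqVneq i k) => [<-//|ik]; exact: d1.
  have -> : row i B2 = 0.
    by apply/rowP => k; rewrite !mxE; case: (eqVneq i k) => [<-//|ik]; exact: d2.
  by rewrite row_mx0.
by move=> /rowP/(_ i)/eqP; rewrite !mxE !eqxx oner_eq0.
Qed.

End conjugate_transpose.

(** * The Evans function *)

Lemma oppmxE (T : zmodType) (m n : nat) (A : 'M[T]_(m, n)) i j : (- A) i j = - A i j.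
Proof. by rewrite mxE. Qed.

Lemma diag_mulmxE (T : pzSemiRingType) (m n : nat) (B : 'M[T]_m) (A : 'M[T]_(m, n))
    i j : is_diag_mx B -> (B *m A) i j = B i i * A i j.
Proof.
move=> /is_diag_mxP d; rewrite mxE (bigD1 i)//= big1 ?addr0// => k ki.
by rewrite d ?mul0r// eq_sym.
Qed.

Lemma in_L1_sub (R : realType) (a b a' b' : R) (V : R -> R[i]) : a <= a' -> b' <= b ->
  in_L1 a b V -> in_L1 a' b' V.
Proof.
move=> aa bb [V1 V2].
have sub : `]a', b'[%classic `<=` `]a, b[%classic.
  by move=> t /=; rewrite !in_itv /=; lra.
by split; apply: integrableS; [|by []|exact: sub|exact: V1| |by []|exact: sub|exact: V2].
Qed.

Definition star_wf (R : realType) (n : nat) (S : star R n) : Prop :=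
  forall i, org S i < tip S i /\ in_L1 (org S i) (tip S i) (pot S i).

(* The self-adjointness conditions at the origin, and at the tips in the scalar
   form that they take when [beta1] and [beta2] are diagonal. *)
Definition org_sa (R : realType) (n : nat) (G : bcond R n) : Prop :=
  \rank (row_mx (alpha1 G) (alpha2 G)) = n /\
  alpha1 G *m adjmx (alpha2 G) = alpha2 G *m adjmx (alpha1 G).

Definition tip_sa (R : realType) (n : nat) (G : bcond R n) : Prop :=
  forall i, (beta1 G i i != 0) || (beta2 G i i != 0) /\
    beta1 G i i * conjc (beta2 G i i) = beta2 G i i * conjc (beta1 G i i).

Section evans.
Variables (R : realType) (n : nat) (S : star R n) (G : bcond R n) (lambda : R[i]).
Hypothesis S_wf : star_wf S.
Hypothesis G_diag : diagonal_ends G.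

Let Y := evansY S G lambda.
Let Z := evansZ S G lambda.

Let org_on i : org S i <= org S i <= tip S i.
Proof. by rewrite lexx ltW//; case: (S_wf i). Qed.

Let tip_on i : org S i <= tip S i <= tip S i.
Proof. by rewrite lexx andbT ltW//; case: (S_wf i). Qed.

Lemma evansYP k m :
  [/\ edge_solution (org S k) (tip S k) (pot S k) lambda (Y k m).1 (Y k m).2,
      (Y k m).1 (org S k) = (- adjmx (alpha2 G)) k m &
      (Y k m).2 (org S k) = adjmx (alpha1 G) k m].
Proof. by apply: cauchy_solutionP => //; case: (S_wf k). Qed.

Lemma evansZP k m :
  [/\ edge_solution (org S k) (tip S k) (pot S k) lambda (Z k m).1 (Z k m).2,
      (Z k m).1 (tip S k) = (- adjmx (beta2 G)) k m &
      (Z k m).2 (tip S k) = adjmx (beta1 G) k m].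
Proof. by apply: cauchy_solutionP => //; case: (S_wf k). Qed.

Lemma evansZ_offdiag k m x : k != m -> org S k <= x <= tip S k ->
  (Z k m).1 x = 0 /\ (Z k m).2 x = 0.
Proof.
move=> km xk; have [sol z1 z2] := evansZP k m.
have [/is_diag_mxP d1 /is_diag_mxP d2] := G_diag.
apply: (edge_solution_eq0 _ (tip_on k) sol _ _ xk); first by case: (S_wf k).
  by rewrite z1 oppmxE adjmxE d2 ?conjc0 ?oppr0// eq_sym.
by rewrite z2 adjmxE d1 ?conjc0// eq_sym.
Qed.

Definition evans_mx (x : 'I_n -> R) : 'M[R[i]]_n :=
  \matrix_(k, m) ((Z k k).2 (x k) * (Y k m).1 (x k) - (Z k k).1 (x k) * (Y k m).2 (x k)).

Lemma evans_det x : on_star S x -> evans S G x lambda = \det (evans_mx x).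
Proof.
move=> xS; rewrite /evans.
have -> : \matrix_(k, m) (evansZ S G lambda k m).1 (x k) =
    diag_mx (\row_k (Z k k).1 (x k)).
  apply/matrixP => k m; rewrite !mxE; case: (eqVneq k m) => [->|km].
    by rewrite mulr1n.
  by rewrite mulr0n (evansZ_offdiag km (xS k)).1.
have -> : \matrix_(k, m) (evansZ S G lambda k m).2 (x k) =
    diag_mx (\row_k (Z k k).2 (x k)).
  apply/matrixP => k m; rewrite !mxE; case: (eqVneq k m) => [->|km].
    by rewrite mulr1n.
  by rewrite mulr0n (evansZ_offdiag km (xS k)).2.
rewrite det_block_diag; congr (\det _); apply/matrixP => k m.
by rewrite !mul_diag_mx !mxE.
Qed.

Lemma evans_mx_const x y : on_star S x -> on_star S y -> evans_mx x = evans_mx y.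
Proof.
move=> xS yS; apply/matrixP => k m; rewrite !mxE.
have [Ys _ _] := evansYP k m; have [Zs _ _] := evansZP k k.
have := wronskian_const Ys Zs (xS k); have := wronskian_const Ys Zs (yS k).
rewrite /wronskian => <- H; rewrite mulrC [X in _ - X]mulrC H; ring.
Qed.

Lemma evans_det_at x y : on_star S x -> on_star S y ->
  evans S G x lambda = \det (evans_mx y).
Proof. by move=> xS yS; rewrite evans_det// (evans_mx_const xS yS). Qed.

Lemma tip_on_star : on_star S (tip S). Proof. by []. Qed.

(** At the tip, the Wronskian of a solution u with the diagonal entry of [Z] is conj(beta1) u +
    conj(beta2) u', which vanishes together with the boundary form of u. *)
Lemma evans_mx_tip (c : 'cV[R[i]]_n) x i : tip_sa G -> on_star S x ->
  ((evans_mx x *m c) i 0 == 0) =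
  (beta1 G i i * (\sum_m c m 0 * (Y i m).1 (tip S i)) +
   beta2 G i i * (\sum_m c m 0 * (Y i m).2 (tip S i)) == 0).
Proof.
move=> G_tip xS; have [gh sa] := G_tip i.
rewrite (evans_mx_const xS tip_on_star) -(self_adjoint_pair _ _ gh sa) mxE.
have [_ z1 z2] := evansZP i i.
congr (_ == 0); rewrite !mulr_sumr -big_split /=; apply: eq_bigr => m _.
rewrite mxE z1 z2 oppmxE !adjmxE; ring.
Qed.

Lemma solution_from_origin (c : 'cV[R[i]]_n) : org_sa G ->
  let u i x := \sum_m c m 0 * (Y i m).1 x in
  let du i x := \sum_m c m 0 * (Y i m).2 x in
  [/\ star_solution S lambda u du, org_form S G u du = 0,
      at_pt u (org S) = - adjmx (alpha2 G) *m c &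
      at_pt du (org S) = adjmx (alpha1 G) *m c].
Proof.
move=> [_ sa] u du.
have u0 : at_pt u (org S) = - adjmx (alpha2 G) *m c.
  apply/colP => i; rewrite !mxE; apply: eq_bigr => m _.
  by have [_ -> _] := evansYP i m; rewrite mulrC.
have du0 : at_pt du (org S) = adjmx (alpha1 G) *m c.
  apply/colP => i; rewrite !mxE; apply: eq_bigr => m _.
  by have [_ _ ->] := evansYP i m; rewrite mulrC.
split => //.
  move=> i; apply: edge_solution_sum; first by case: (S_wf i) => /ltW.
  by move=> k; have [] := evansYP i k.
by rewrite /org_form u0 du0 !mulmxA mulmxN sa mulNmx addNr.
Qed.

(** [self_adjoint_kernel] provides a [c] matching the Cauchy data at the origin, and uniqueness on
    each edge extends the equality. *)
Lemma solution_to_origin (u du : 'I_n -> R -> R[i]) : org_sa G ->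
  star_solution S lambda u du -> org_form S G u du = 0 ->
  exists c : 'cV[R[i]]_n, forall i x, org S i <= x <= tip S i ->
    u i x = \sum_m c m 0 * (Y i m).1 x /\ du i x = \sum_m c m 0 * (Y i m).2 x.
Proof.
move=> /[dup] osa [rk sa] us uo.
have [c [u0 du0]] := self_adjoint_kernel rk sa uo.
exists c => i x xi.
have [sol _ v0 dv0] := solution_from_origin c osa.
have [V1 V2] := S_wf i.
apply: (edge_solution_unique V2 (org_on i) (us i) (sol i) _ _ xi).
  by move/colP/(_ i) : v0; rewrite -u0 !mxE => <-.
by move/colP/(_ i) : dv0; rewrite -du0 !mxE => <-.
Qed.

(** For a null vector [c] of the Wronskian matrix, Y c satisfies all conditions, so it vanishes by
    injectivity. Its data at the origin are - alpha2^* c and alpha1^* c, and the rank condition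
    gives [c = 0]. *)
Lemma evans_neq0 x : org_sa G -> tip_sa G -> on_star S x ->
  in_resolvent_set S G lambda -> evans S G x lambda != 0.
Proof.
move=> osa tsa xS [_ inj _]; rewrite evans_det// -det_tr.
apply/negP => /det0P[v v0 vF].
pose c := v^T; have Fc : evans_mx x *m c = 0.
  by apply: trmx_inj; rewrite trmx_mul trmxK trmx0.
have [sol uo u0 du0] := solution_from_origin c osa.
set u := fun i x => _ in sol uo u0; set du := fun i x => _ in sol uo du0.
have ab i : org S i <= tip S i by case: (S_wf i) => /ltW.
have ut : tip_form S G u du = 0.
  have [d1 d2] := G_diag; apply/colP => i; rewrite [RHS]mxE; apply/eqP.
  have := evans_mx_tip c i tsa xS; rewrite Fc mxE eqxx => /esym.
  by rewrite /tip_form mxE !diag_mulmxE// !mxE.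
have usol : star_op_shift S G lambda u (fun _ _ => 0).
  split; first by move=> i; apply: abs_cont_in_L2 => //; exact: abs_cont_cst.
  exists du; split => //.
  - by move=> i; have [] := sol i.
  - move=> i; apply: abs_cont_in_L2 => //; apply: abs_contD; first exact: abs_cont_cst.
    by apply: abs_contZ => //; have [[]] := sol i.
  - move=> i; have [_] := sol i; apply: filterS; last by move=> t H /H; rewrite add0r.
    exact: (ae_filter_ringOfSetsType lebesgue_measure).
have u_ae0 := inj _ usol.
have z i : u i (org S i) = 0 /\ du i (org S i) = 0.
  have [lt _] := S_wf i; have [reg _] := sol i.
  exact: (regular_ae0 lt reg (u_ae0 i)).
have c0 : c = 0.
  have [rk _] := osa; apply: (adjmx_row_free_inj rk).
    by rewrite -du0; apply/colP => i; rewrite !mxE (z i).2.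
  by apply: oppr_inj; rewrite -mulNmx -u0 oppr0; apply/colP => i; rewrite !mxE (z i).1.
by move: v0; rewrite -[v]trmxK -/c c0 trmx0 eqxx.
Qed.

End evans.

(** * The splitting formula *)

Lemma set_entry_diag (R : realType) (n : nat) (A : 'M[R[i]]_n) (j : 'I_n) (c : R[i]) :
  is_diag_mx A -> is_diag_mx (set_entry A j c).
Proof.
move=> /is_diag_mxP dA; apply/is_diag_mxP => i k ik; rewrite mxE.
by case: ifP => [/andP[/eqP ij /eqP kj]|_]; [rewrite ij kj eqxx in ik|exact: dA].
Qed.

(** Serves the first subgraph, whose origin [s] carries the Dirichlet condition. *)
Lemma scalar_org_sa (R : realType) (n : nat) (G : bcond R n) :
  alpha1 G = 1%:M -> alpha2 G = 0 -> org_sa G.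
Proof.
move=> a1 a2; rewrite /org_sa a1 a2 adjmx0 mulmx0 mul0mx; split => //.
apply/eqP; rewrite -/(row_free _) ; apply/row_freeP.
by exists (col_mx 1%:M 0); rewrite mul_row_col mulmx1 mulmx0 addr0.
Qed.

(* The maps M_1(lambda), M_2(lambda) act on C; the identity is that M_1 + M_2 is
   multiplication by the quotient of Evans functions, for every choice of the
   points x, x1, x2 at which the determinants are evaluated. *)
Theorem theorem1p5 (R : realType) (n : nat) (l : 'I_n -> R)
    (V : 'I_n -> R -> R[i]) (G : bcond R n) (j : 'I_n) (s : R) (lambda : R[i])
    (l_gt0 : forall i, 0 < l i)
    (V_L1 : forall i, in_L1 0 (l i) (V i))
    (G_sa : self_adjoint_bc G)
    (G_diag : diagonal_ends G)
    (s_in : 0 < s < l j)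
    (rho1 : in_resolvent_set (star1 l V j s) (bcond1 G j) lambda)
    (rho2 : in_resolvent_set (star2 l V j s) (bcond2 G j) lambda)
    (x : 'I_n -> R) (x1 : 'I_1 -> R) (x2 : 'I_n -> R)
    (x_on : on_star (star0 l V) x)
    (x1_on : on_star (star1 l V j s) x1)
    (x2_on : on_star (star2 l V j s) x2)
    (f : R[i]) :
  evans (star0 l V) G x lambda
    / (evans (star1 l V j s) (bcond1 G j) x1 lambda
       * evans (star2 l V j s) (bcond2 G j) x2 lambda) * f
  = two_sided_map l V G j s lambda f.
Proof.
have /andP[s0 sl] := s_in; have [s0' sl'] := (ltW s0, ltW sl).
have [rka rkb saa sab] := G_sa; have [d1 d2] := G_diag.
pose S0 := star0 l V; pose S1 := star1 l V j s; pose S2 := star2 l V j s.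
pose G1 := bcond1 G j; pose G2 := bcond2 G j.
have wf0 : star_wf S0 by move=> i; split; [exact: l_gt0|exact: V_L1].
have wf1 : star_wf S1.
  by move=> i; split=> //=; apply: in_L1_sub (V_L1 j).
have wf2 : star_wf S2.
  move=> i /=; case: eqVneq => [->|_]; split => //.
  exact: in_L1_sub (V_L1 j).
have dg1 : diagonal_ends G1 by split; exact: scalar_mx_is_diag.
have dg2 : diagonal_ends G2. by split; exact: set_entry_diag.
have tsa0 : tip_sa G.
  move=> i; split; first exact: diag_row_mx_neq0 rkb.
  have := congr1 (fun A : 'M[R[i]]_n => A i i) sab.
  by rewrite !diag_mulmxE// !adjmxE.
have tsa1 : tip_sa G1.
  by move=> i; rewrite /G1 /= !mxE ord1 eqxx !mulr1n; have [] := tsa0 j.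
have tsa2 : tip_sa G2.
  move=> i; rewrite /G2 /= !mxE andbb; case: (eqVneq i j) => [_|_]; last by have [] := tsa0 i.
  by rewrite oner_neq0 conjc0 mulr0 mul0r.
have osa2 : org_sa G2 by [].
have osa1 : org_sa G1 by exact: scalar_org_sa.
(* A common evaluation point: it lies on both the full graph and the second subgraph, and equals [s]
   on edge [j]. *)
pose y := tip S2.
have y0 : on_star S0 y.
  move=> i; rewrite /y /=; case: eqVneq => [->|_]; first by rewrite s0' sl'.
  by rewrite lexx ltW.
have y2 : on_star S2 y.
  by move=> i; rewrite lexx andbT; case: (wf2 i) => /ltW.
have s1 : on_star S1 (fun=> s) by move=> i; rewrite /= lexx sl'.
have yj : y j = s by rewrite /y /= eqxx.
pose F0 := evans_mx S0 G lambda y.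
pose F2 := evans_mx S2 G2 lambda y.
pose Z1 := evansZ S1 G1 lambda 0 0; pose z := Z1.1 s; pose dz := Z1.2 s.
pose Y2 := evansY S2 G2 lambda.
(* On the first subgraph Y has data (0, 1) at [s], so only [- z] remains of the one by one
   determinant. *)
have E1 : evans S1 G1 x1 lambda = - z.
  rewrite (evans_det_at lambda wf1 dg1 x1_on s1) det_mx11 mxE.
  have [_ -> ->] := evansYP G1 lambda wf1 0 0.
  rewrite oppmxE !adjmxE.
  have -> : alpha2 G1 0 0 = 0 by rewrite mxE.
  have -> : alpha1 G1 0 0 = 1 by rewrite mxE eqxx mulr1n.
  by rewrite conjc0 conjc1 oppr0 mulr0 mulr1 sub0r.
have z0 : z != 0.
  by have := evans_neq0 wf1 dg1 osa1 tsa1 x1_on rho1; rewrite E1 oppr_eq0.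
have E2 : evans S2 G2 x2 lambda = \det F2 by exact: evans_det_at.
have F20 : \det F2 != 0.
  by rewrite -E2; exact: evans_neq0.
have E0 : evans S0 G x lambda = \det F0 by exact: evans_det_at.
(* The Dirichlet condition at the cut gives Z the data (0, 1) there. *)
have F2j m : F2 j m = (Y2 j m).1 s.
  rewrite mxE -/Y2 yj.
  have [_ + +] := evansZP G2 lambda wf2 j j; rewrite oppmxE !adjmxE.
  have -> : tip S2 j = s by exact: yj.
  move=> -> ->.
  have -> : beta1 G2 j j = 1 by rewrite mxE eqxx.
  have -> : beta2 G2 j j = 0 by rewrite mxE eqxx.
  by rewrite conjc0 conjc1 mul1r oppr0 mul0r subr0.
(* Away from edge [j] the two Cauchy problems coincide literally, and so do the selected
   solutions. *)
have F0k k m : k != j -> F0 k m = F2 k m.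
  move=> kj; rewrite !mxE /evansZ /evansY.
  have -> : tip S2 k = l k by rewrite /= (negbTE kj).
  by rewrite !oppmxE !adjmxE /G2 /= !mxE (negbTE kj).
(* On edge [j] the intervals differ: Y is compared with [Y2] on [[0, s]] and Z with [Z1] on
   [[s, l j]], each by uniqueness after restriction. *)
have F0j m : F0 j m = dz * (Y2 j m).1 s - z * (Y2 j m).2 s.
  rewrite mxE yj.
  have [Y0s Y00 Y01] := evansYP G lambda wf0 j m.
  have [Y2s Y20 Y21] := evansYP G2 lambda wf2 j m.
  have [Z0s Z00 Z01] := evansZP G lambda wf0 j j.
  have [Z1s Z10 Z11] := evansZP G1 lambda wf1 0 0.
  have [wl0 wL0] := wf0 j; have [wl1 wL1] := wf1 0; have [wl2 wL2] := wf2 j.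
  have tj : tip S2 j = s := yj.
  have Y0s' : edge_solution (org S2 j) (tip S2 j) (pot S2 j) lambda
      (evansY S0 G lambda j m).1 (evansY S0 G lambda j m).2.
    by rewrite tj; exact: (edge_solution_sub (lexx 0) sl' Y0s).
  have on2 : org S2 j <= org S2 j <= tip S2 j by rewrite lexx ltW.
  have sn2 : org S2 j <= s <= tip S2 j by rewrite tj lexx s0'.
  have [|| -> ->] := edge_solution_unique wL2 on2 Y0s' Y2s _ _ sn2.
  - by rewrite Y20; exact: Y00.
  - by rewrite Y21; exact: Y01.
  have Z0s' : edge_solution (org S1 0) (tip S1 0) (pot S1 0) lambda
      (evansZ S0 G lambda j j).1 (evansZ S0 G lambda j j).2.
    exact: (edge_solution_sub s0' (lexx _) Z0s).
  have on1 : org S1 0 <= tip S1 0 <= tip S1 0 by rewrite lexx ltW.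
  have sn1 : org S1 0 <= s <= tip S1 0 by rewrite /= lexx sl'.
  have [|| -> ->] := edge_solution_unique wL1 on1 Z0s' Z1s _ _ sn1 => //.
  - rewrite Z10 oppmxE adjmxE /G1 /= mxE eqxx mulr1n.
    by move: Z00; rewrite oppmxE adjmxE.
  - rewrite Z11 adjmxE /G1 /= mxE eqxx mulr1n.
    by move: Z01; rewrite adjmxE.
have m1 : M1 l V G j s lambda f = - (f * dz / z).
  have [Zs Zt dZt] := evansZP G1 lambda wf1 0 0.
  have [gh sa] := tsa1 0.
  have t1 : org S1 0 <= tip S1 0 <= tip S1 0 by rewrite lexx andbT.
  have tipE u du : tip_form S1 G1 u du 0 0 =
      beta1 G1 0 0 * u 0 (l j) + beta2 G1 0 0 * du 0 (l j).
    by rewrite /tip_form mxE !diag_mulmxE ?(proj1 dg1) ?(proj2 dg1)// !mxE.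
  (* The Wronskian of the selected solution with [Z1] vanishes at the tip, hence at [s], which
     determines its derivative there. The multiple [f / z] of [Z1] shows that there is something to
     select. *)
  rewrite /M1 /M1_solution; case: xgetP => [p _ [ps pt pf]|none].
    have := wronskian_const (ps 0) Zs t1; rewrite /wronskian pf.
    have pt' : conjc (beta1 G1 0 0) * p.1 0 (l j) + conjc (beta2 G1 0 0) * p.2 0 (l j) = 0.
      by apply/eqP; rewrite (self_adjoint_pair _ _ gh sa) -tipE pt mxE.
    rewrite Zt dZt oppmxE !adjmxE mulrN opprK mulrC [X in _ + X]mulrC pt'.
    move=> /esym/eqP; rewrite subr_eq0 -/Z1 -/z -/dz => /eqP ->.
    by rewrite mulfK.
  exfalso; apply: (none (fun _ t => f / z * Z1.1 t, fun _ t => f / z * Z1.2 t)).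
  split => /=.
  - move=> i; rewrite (ord1 i); apply: edge_solutionZ; [exact: sl'|exact: Zs].
  - apply/colP => i; rewrite (ord1 i) [RHS]mxE; apply/eqP.
    rewrite tipE -(self_adjoint_pair _ _ gh sa) Zt dZt oppmxE !adjmxE; apply/eqP.
    ring.
  - by rewrite -/z mulfVK.
have m2 : exists2 c : 'cV[R[i]]_n, F2 *m c = f *: delta_mx j 0 &
    M2 l V G j s lambda f = \sum_m c m 0 * (Y2 j m).2 s.
  have sn2 : org S2 j <= s <= tip S2 j by rewrite -/y yj lexx s0'.
  have tipE u du i : tip_form S2 G2 u du i 0 =
      beta1 G2 i i * u i (tip S2 i) + beta2 G2 i i * du i (tip S2 i).
    by rewrite /tip_form mxE !diag_mulmxE ?(proj1 dg2) ?(proj2 dg2)// !mxE.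
  have rowj (c : 'cV[R[i]]_n) : (F2 *m c) j 0 = \sum_m c m 0 * (Y2 j m).1 s.
    by rewrite mxE; apply: eq_bigr => m _; rewrite F2j mulrC.
  rewrite /M2 /M2_solution; case: xgetP => [p _ [ps po pt pf]|none].
    have [c cE] := solution_to_origin wf2 osa2 ps po.
    exists c; last exact: (cE j s sn2).2.
    apply/colP => i; have [->|ij] := eqVneq i j.
      by rewrite rowj -(cE j s sn2).1 pf !mxE !eqxx mulr1.
    rewrite !mxE (negbTE ij) mulr0; apply/eqP.
    have ti : org S2 i <= tip S2 i <= tip S2 i by exact: y2.
    have := evans_mx_tip lambda wf2 c i tsa2 y2; rewrite mxE => ->.
    by rewrite -(cE i _ ti).1 -(cE i _ ti).2 -tipE pt.
  (* Existence: [\det F2 != 0] allows the linear system for the coefficients to be solved. *)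
  pose c : 'cV[R[i]]_n := invmx F2 *m (f *: delta_mx j 0).
  have Fc : F2 *m c = f *: delta_mx j 0.
    by rewrite mulmxA mulmxV ?mul1mx// unitmxE unitfE.
  have [sol uo _ _] := solution_from_origin lambda wf2 c osa2.
  exfalso; apply: (none (_, _)); split; [exact: sol|exact: uo| |].
  - move=> i ij /=; rewrite tipE; apply/eqP.
    rewrite -(evans_mx_tip lambda wf2 c i tsa2 y2) -/F2 Fc.
    by rewrite !mxE (negbTE ij) mulr0.
  - by rewrite /= -rowj Fc !mxE !eqxx mulr1.
have [c Fc M2E] := m2.
have cramer m : \det F2 * c m 0 = cofactor F2 j m * f.
  have := congr1 (mulmx (\adj F2)) Fc; rewrite mulmxA mul_adj_mx mul_scalar_mx.
  move=> /colP/(_ m); rewrite mxE => ->.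
  rewrite -scalemxAr mxE mulrC; congr (_ * f).
  by rewrite -colE !mxE.
have cof m : cofactor F0 j m = cofactor F2 j m.
  rewrite /cofactor; congr (_ * \det _); apply/matrixP => i k.
  rewrite 2!mxE [RHS]mxE [in RHS]mxE.
  by rewrite F0k// eq_sym neq_lift.
(* The factor [f] turns each cofactor into [\det F2 * c m 0]; keeping it on both sides covers
   [f = 0] as well. *)
have detE : \det F0 * f = \det F2 * (dz * f - z * M2 l V G j s lambda f).
  have fE : f = \sum_m (Y2 j m).1 s * c m 0.
    have /colP/(_ j) := Fc; rewrite !mxE !eqxx mulr1 => <-.
    by apply: eq_bigr => m _; rewrite F2j.
  rewrite (expand_det_row _ j) mulr_suml.
  rewrite {2}fE M2E !mulr_sumr -sumrB mulr_sumr; apply: eq_bigr => m _.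
  by rewrite F0j cof -mulrA -cramer; ring.
rewrite /two_sided_map -/S0 -/S1 -/S2 -/G1 -/G2 E0 E1 E2 m1.
rewrite mulrAC detE; field.
by rewrite z0 F20.
Qed.
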